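(* Let $r,k\in\mathbb Z$, $0\le k\le r$. Let $u$ be the exact solution of the initial value problem $Mu'=F(\cdot,u)$, $u(t_0)=u_0$, let $\widetilde U$ be the solution of the collocation method with respect to the quadrature points of $Q^r_k$, and suppose that the error estimates $$\sup_{t\in I}\big\|(u-\widetilde U)(t)\big\|\le C(F,u)\,\tau^{\min\{2r-k+1,\,(r+1)+1\}}$$ and $$\sup_{t\in I}\big\|(u-\widetilde U)^{(l)}(t)\big\|\le C(F,u)\,\tau^{(r+1)+1-l},\qquad1\le l\le r+1,$$ hold. Then the solution $U$ of $Q^r_k\text{-}\mathbf{VTD}^r_k$ satisfies $$\sup_{t\in I}\big\|(u-U)(t)\big\|\le C(F,u)\,\tau^{r+1}$$ and $$\sup_{t\in I}\big\|(u-U)^{(l)}(t)\big\|\le C(F,u)\,\tau^{r+1-l},\qquad1\le l\le r,$$ where the derivatives are understood in an interval-wise sense.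
   Context: Problem: $M u'(t)=F(t,u(t))$, $u(t_0)=u_0\in\mathbb R^d$, on $I=(t_0,t_0+T]$, $T>0$, with $M\in\mathbb R^{d\times d}$ regular; $F$ is sufficiently smooth (all derivatives of $F$ and of $u$ that occur exist and are continuous) and Lipschitz continuous in its second variable. $C(F,u)$ denotes a generic constant (possibly different at each occurrence) depending on $F,u$ (and on fixed data such as $r,k,T$) but independent of the time mesh parameter $\tau$; estimates are for all time meshes under consideration. ''The solution'' presupposes that the discrete solutions exist and are unique. Notation: mesh $t_0<t_1<\dots<t_N=t_0+T$, $I_n=(t_{n-1},t_n]$, $\tau_n=t_n-t_{n-1}$, $\tau=\max_n\tau_n$. $(\cdot,\cdot)$, $\|\cdot\|$ are the Euclidean inner product and norm on $\mathbb R^d$. $P_s(J,\mathbb R^q)$ is the space of $\mathbb R^q$-valued polynomials on $J$ of degree $\le s$. $Y_s$ is the space of functions $\varphi\in L^2(I,\mathbb R^d)$ with $\varphi|_{I_n}\in P_s(I_n,\mathbb R^d)$ for all $n$. $v(t_n^\pm)$ are one-sided limits, $[v]_n=v(t_n^+)-v(t_n^-)$. $\delta_{i,j}$ is the Kronecker delta. Interpolation and quadrature: for $0\le k\le r$ let $\widehat{\mathcal I}^r_k:C^{\lfloor k/2\rfloor}([-1,1])\to P_r([-1,1])$ be the Hermite interpolation operator preserving derivatives of orders $0,\dots,\lfloor\frac{k-1}{2}\rfloor$ at $-1$ (none if $k=0$), derivatives of orders $0,\dots,\lfloor\frac k2\rfloor$ at $+1$, and the function values at the zeros $\hat t_1,\dots,\hat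 t_{r-k}\in(-1,1)$ of the $(r-k)$th Jacobi polynomial with respect to the weight $(1+\hat t)^{\lfloor\frac{k-1}{2}\rfloor+1}(1-\hat t)^{\lfloor\frac k2\rfloor+1}$. Let $\widehat Q^r_k[\hat f]=\int_{-1}^1\widehat{\mathcal I}^r_k\hat f\,\mathrm d\hat t$; $\mathcal I^r_k$ and $Q^r_k$ denote their affine transformations to $I_n$ (so $Q^r_k[\varphi]=\int_{I_n}\mathcal I^r_k\varphi\,\mathrm dt$), and $t_{n,i}=\frac12(t_{n-1}+t_n+\tau_n\hat t_i)$, $i=1,\dots,r-k$. Collocation method with respect to the quadrature points of $Q^r_k$: $\widetilde U\in Y_{r+1}$ with $\widetilde U(t_0^-)=u_0$ such that for all $n=1,\dots,N$: $\widetilde U(t_{n-1}^+)=\widetilde U(t_{n-1}^-)$; $M\widetilde U^{(i+1)}(t_n^-)=\frac{\mathrm d^i}{\mathrm dt^i}(F(t,\widetilde U(t)))|_{t=t_n^-}$ for $i=0,\dots,\lfloor\frac k2\rfloor$; if $k\ge1$, $M\widetilde U^{(i+1)}(t_{n-1}^+)=\frac{\mathrm d^i}{\mathrm dt^i}(F(t,\widetilde U(t)))|_{t=t_{n-1}^+}$ for $i=0,\dots,\lfloor\frac{k-1}2\rfloor$; and $M\widetilde U'(t_{n,i})=F(t_{n,i},\widetilde U(t_{n,i}))$ for $i=1,\dots,r-k$. Method $Q^r_k\text{-}\mathbf{VTD}^r_k$: $U\in Y_r$ with $U(t_0^-)=u_0$ such that for every $n=1,\dots,N$: (1) if $k\ge1$: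 $U(t_{n-1}^+)=U(t_{n-1}^-)$; (2) if $k\ge2$: $M U^{(i+1)}(t_n^-)=\frac{\mathrm d^i}{\mathrm dt^i}\big(F(t,U(t))\big)\big|_{t=t_n^-}$ for $i=0,\dots,\lfloor\frac k2\rfloor-1$; (3) if $k\ge3$: $M U^{(i+1)}(t_{n-1}^+)=\frac{\mathrm d^i}{\mathrm dt^i}\big(F(t,U(t))\big)\big|_{t=t_{n-1}^+}$ for $i=0,\dots,\lfloor\frac{k-1}2\rfloor-1$; (4) $Q^r_k\big[(MU',\varphi)\big]+\delta_{0,k}\big(M[U]_{n-1},\varphi(t_{n-1}^+)\big)=Q^r_k\big[(F(\cdot,U(\cdot)),\varphi)\big]$ for all $\varphi\in P_{r-k}(I_n,\mathbb R^d)$. *)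

(* Defs.v *)
From HB Require Import structures.
From mathcomp Require Import all_boot all_order all_algebra.
From mathcomp Require Import all_classical all_reals all_analysis.
Set Implicit Arguments.
Unset Strict Implicit.
Unset Printing Implicit Defensive.
Import Order.TTheory GRing.Theory Num.Theory.
Import numFieldNormedType.Exports.
Local Open Scope classical_set_scope.
Local Open Scope ring_scope.

Definition inner (R : realType) (d : nat) (x y : 'cV[R]_d) : R :=
  \sum_(i < d) x i 0 * y i 0.

(* The norm of the library on matrices is the max norm. *)
Definition enorm (R : realType) (d : nat) (x : 'cV[R]_d) : R :=
  Num.sqrt (inner x x).

(* f^(i)(t^-) and f^(i)(t^+).  If f is of class C^i on [a, b], then dminus i f
   is the i-th derivative on ]a, b[ and the one-sided one at b. *)
Definition dminus (R : realType) (V : normedModType R) (i : nat) (f : R -> V)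
  (t : R) : V := lim (derive1n i f s @[s --> t^'-]).

Definition dplus (R : realType) (V : normedModType R) (i : nat) (f : R -> V)
  (t : R) : V := lim (derive1n i f s @[s --> t^'+]).

(* Class C^m on the compact interval [a, b]: the derivatives up to order m exist
   on ]a, b[ and extend continuously to [a, b]. *)
Fixpoint Cn_interval (R : realType) (V : normedModType R) (a b : R) (m : nat)
    (f : R -> V) : Prop :=
  {within `[a, b], continuous f} /\
  (if m is m'.+1 then
     exists f' : R -> V,
       (forall t, a < t < b -> is_derive t 1 f (f' t)) /\ Cn_interval a b m' f'
   else True).

(* Class C^m on the closed slab [a, b] x R^d: the derivatives up to order m exist
   on the open slab and extend continuously to the closed one. *)
Fixpoint Cn_slab (R : realType) (d : nat) (a b : R) (m : nat)
    (G : R * 'cV[R]_d -> 'cV[R]_d) : Prop :=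
  {within `[a, b] `*` [set: 'cV[R]_d], continuous G} /\
  (if m is m'.+1 then
     (forall x : R * 'cV[R]_d, a < x.1 < b -> differentiable G x) /\
     forall v : R * 'cV[R]_d, exists G' : R * 'cV[R]_d -> 'cV[R]_d,
       (forall x : R * 'cV[R]_d, a < x.1 < b -> 'D_v G x = G' x) /\
       Cn_slab a b m' G'
   else True).

Definition lipschitz_snd (R : realType) (d : nat) (a b : R)
    (F : R -> 'cV[R]_d -> 'cV[R]_d) : Prop :=
  exists L : R, forall t, a <= t <= b -> forall y z,
    enorm (F t y - F t z) <= L * enorm (y - z).

Definition exact_solution (R : realType) (d : nat) (t0 T : R) (M : 'M[R]_d)
    (F : R -> 'cV[R]_d -> 'cV[R]_d) (u0 : 'cV[R]_d) (u : R -> 'cV[R]_d) : Prop :=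
  u t0 = u0 /\
  forall t, t0 < t <= t0 + T -> M *m dminus 1 u t = F t (u t).

(* Hermite interpolation and quadrature on [-1, 1]. *)

(* floor ((k - 1) / 2) + 1 for all k >= 0, i.e. the number of derivatives
   (including the value) preserved at -1; at +1 it is k./2.+1. *)
Definition nleft (k : nat) : nat := uphalf k.

Definition jacobi_poly (R : realType) (r k : nat) (J : {poly R}) : Prop :=
  size J = (r - k).+1 /\
  forall q : {poly R}, (size q <= r - k)%N ->
    \int[lebesgue_measure]_(s in `[-1, 1])
      ((1 + s) ^+ nleft k * (1 - s) ^+ (k./2).+1 * J.[s] * q.[s]) = 0.

(* that lists the r - k zeros of the Jacobi polynomial in increasing order. *)
Definition jacobi_zeros (R : realType) (r k : nat) (that : 'I_(r - k) -> R)
    : Prop :=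
  (forall i, -1 < that i < 1) /\
  (forall i j : 'I_(r - k), (i < j)%N -> that i < that j) /\
  exists J : {poly R}, jacobi_poly r k J /\ forall i, root J (that i).

Definition hermite_interpolates (R : realType) (r k : nat)
    (that : 'I_(r - k) -> R) (f : R -> R) (p : {poly R}) : Prop :=
  [/\ (size p <= r.+1)%N,
      (forall i, (i < nleft k)%N -> (derivn i p).[-1] = dplus i f (-1)),
      (forall i, (i <= k./2)%N -> (derivn i p).[1] = dminus i f 1) &
      (forall j, p.[that j] = f (that j))].

Definition hermite (R : realType) (r k : nat) (that : 'I_(r - k) -> R)
    (f : R -> R) : {poly R} :=
  xget 0 [set p | hermite_interpolates that f p].

Definition from_ref (R : realType) (a b s : R) : R := (a + b + (b - a) * s) / 2.

Definition to_ref (R : realType) (a b t : R) : R := (2 * t - a - b) / (b - a).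

Definition interp (R : realType) (r k : nat) (that : 'I_(r - k) -> R) (a b : R)
    (f : R -> R) (t : R) : R :=
  (hermite that (f \o from_ref a b)).[to_ref a b t].

Definition quad (R : realType) (r k : nat) (that : 'I_(r - k) -> R) (a b : R)
    (f : R -> R) : R :=
  \int[lebesgue_measure]_(t in `[a, b]) interp that a b f t.

(* Meshes node 0 < ... < node steps; node is irrelevant beyond steps. *)
Record mesh (R : realType) := Mesh { steps : nat; node : nat -> R }.

Definition mesh_of (R : realType) (t0 T : R) (m : mesh R) : Prop :=
  [/\ node m 0%N = t0, node m (steps m) = t0 + T &
      forall n, (n < steps m)%N -> node m n < node m n.+1].

Definition mesh_size (R : realType) (m : mesh R) : R :=
  \big[Num.max/0]_(n < steps m) (node m n.+1 - node m n).

(* A piecewise polynomial function is given by its pieces: V n is the polynomial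
   on ]node m n, node m n.+1], for n < steps m.  One-sided limits at the nodes
   are then values of the pieces, and interval-wise derivatives are derivatives
   of the pieces. *)
Definition pieces (R : realType) (d : nat) : Type := nat -> 'cV[{poly R}]_d.

Definition peval (R : realType) (d : nat) (i : nat) (p : 'cV[{poly R}]_d) (t : R)
    : 'cV[R]_d := \col_j (derivn i (p j 0)).[t].

Definition deg_le (R : realType) (d s : nat) (p : 'cV[{poly R}]_d) : Prop :=
  forall j, (size (p j 0%R) <= s.+1)%N.

Definition in_Y (R : realType) (d : nat) (m : mesh R) (s : nat) (V : pieces R d)
    : Prop := forall n, (n < steps m)%N -> deg_le s (V n).

(* V(t_n^-), where V(t_0^-) is the initial value. *)
Definition left_value (R : realType) (d : nat) (m : mesh R) (u0 : 'cV[R]_d)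
    (V : pieces R d) (n : nat) : 'cV[R]_d :=
  if n is n'.+1 then peval 0 (V n') (node m n) else u0.

Definition collocation (R : realType) (d r k : nat) (that : 'I_(r - k) -> R)
    (M : 'M[R]_d) (F : R -> 'cV[R]_d -> 'cV[R]_d) (u0 : 'cV[R]_d) (m : mesh R)
    (V : pieces R d) : Prop :=
  in_Y m r.+1 V /\
  forall n, (n < steps m)%N ->
    let a := node m n in
    let b := node m n.+1 in
    let FV := fun t => F t (peval 0 (V n) t) in
    [/\ peval 0 (V n) a = left_value m u0 V n,
        (forall i, (i <= k./2)%N -> M *m peval i.+1 (V n) b = dminus i FV b),
        (forall i, (i < nleft k)%N -> M *m peval i.+1 (V n) a = dplus i FV a) &
        (forall j, let t := from_ref a b (that j) in
           M *m peval 1 (V n) t = FV t)].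

Definition vtd (R : realType) (d r k : nat) (that : 'I_(r - k) -> R)
    (M : 'M[R]_d) (F : R -> 'cV[R]_d -> 'cV[R]_d) (u0 : 'cV[R]_d) (m : mesh R)
    (V : pieces R d) : Prop :=
  in_Y m r V /\
  forall n, (n < steps m)%N ->
    let a := node m n in
    let b := node m n.+1 in
    let FV := fun t => F t (peval 0 (V n) t) in
    [/\ ((1 <= k)%N -> peval 0 (V n) a = left_value m u0 V n),
        (forall i, (i < k./2)%N -> M *m peval i.+1 (V n) b = dminus i FV b),
        (forall i, (i < k.-1./2)%N -> M *m peval i.+1 (V n) a = dplus i FV a) &
        (forall phi : 'cV[{poly R}]_d, deg_le (r - k) phi ->
           quad that a b (fun t => inner (M *m peval 1 (V n) t) (peval 0 phi t))
           + (k == 0%N)%:R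
             * inner (M *m (peval 0 (V n) a - left_value m u0 V n))
                     (peval 0 phi a)
           = quad that a b (fun t => inner (FV t) (peval 0 phi t)))].

Definition unique_solution (R : realType) (d : nat) (m : mesh R)
    (P : pieces R d -> Prop) (V : pieces R d) : Prop :=
  P V /\ forall W, P W -> forall n, (n < steps m)%N -> W n = V n.

(* sup over t in I of || (u - V)^(l) (t) ||, derivatives being interval-wise, so
   that the derivative of u at a node is taken from the left. *)
Definition sup_error (R : realType) (d : nat) (m : mesh R) (u : R -> 'cV[R]_d)
    (V : pieces R d) (l : nat) : \bar R :=
  ereal_sup [set e | exists n t,
    [/\ (n < steps m)%N, node m n < t <= node m n.+1 &
        e = (enorm (dminus l u t - peval l (V n) t))%:E]].

(* Main.v *)
Require Import Defs.
From mathcomp Require Import all_boot all_order all_algebra.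
From mathcomp Require Import all_classical all_reals all_analysis.
From mathcomp Require Import ring lra zify.
Import Order.TTheory GRing.Theory Num.Theory.
Import numFieldNormedType.Exports.
Local Open Scope classical_set_scope.
Local Open Scope ring_scope.
Set Implicit Arguments.
Unset Strict Implicit.
Unset Printing Implicit Defensive.

(** The theorem holds because the solution [U] of the variational method is the
    Hermite interpolant, for the nodes of the quadrature rule, of the collocation
    solution [W].  On a mesh interval [[a, b]] let [theta] be the polynomial of
    degree [r + 1] that vanishes, with multiplicities, at the interpolation
    points.  Subtracting from [W], of degree at most [r + 1], the multiple
    [c theta] that cancels the leading coefficient gives a polynomial [V] of
    degree at most [r] with the same Hermite data as [W].

    That [V] solves the variational problem is seen as follows.  At the end points
    [V] and [W] have the same derivatives up to the orders interpolated there, so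
    that by the chain rule the right-hand sides [F(t, V)] and [F(t, W)] have the
    same one-sided derivatives ([eqjet_slab]); the point conditions for [V] are
    therefore among the collocation conditions for [W].  For the same reason
    [Q[(F(t, V), phi)] = Q[(M W', phi)]] ([quad_reduced]), because the rule [Q]
    only sees Hermite data.  Finally [Q[(M W', phi)]] and [Q[(M V', phi)]] are
    exact integrals ([quad_poly]) and differ by the integral of
    [theta' (M c, phi)]; as [theta] is orthogonal to polynomials of degree below
    [r - k], integration by parts leaves [- theta(a) (M c, phi(a))], which is
    zero for [k > 0] and is balanced by the jump term for [k = 0]
    ([quad_reduced_deriv]).  Uniqueness of the discrete solution gives [U = V].

    Hence [u - U = (u - W) + c theta].  The first term is bounded by assumption.
    In the second, the leading coefficient of [W] is bounded, since its derivative
    of order [r + 1] is close to that of [u]; scaling [theta] from the reference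
    interval shows that the derivative of order [l] of [c theta] is of the order
    of the step size to the power [r + 1 - l] ([reduced_error]). *)

(** * Polynomials with prescribed multiple roots *)

Section MultipleRoots.
Context {R : numFieldType}.
Implicit Types (p q : {poly R}) (x : R).

Lemma dvdp_exp_deriv n x p :
  ('X - x%:P) ^+ n.+1 %| p -> ('X - x%:P) ^+ n %| p^`().
Proof.
move=> /dvdpP[q ->]; rewrite derivM deriv_exp derivXsubC mul1r; apply: dvdp_add.
  by rewrite exprS mulrA dvdp_mull.
by rewrite mulrnAr -mulrnAl dvdp_mull.
Qed.

(** The Taylor expansion of [p] at [x] shows that the derivatives of order below
[n] vanish exactly when [('X - x)^n] can be factored out. *)
Lemma dvdp_exp_derivn n x p :
  ('X - x%:P) ^+ n %| p <-> forall i, (i < n)%N -> p^`(i).[x] = 0.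
Proof.
split=> [xp i|p0].
  elim: i n p xp => [|i IH] [//|n] p xp ltin.
    rewrite derivn0; apply/rootP; rewrite -dvdp_XsubCl.
    by apply: dvdp_trans xp; rewrite exprS dvdp_mulr.
  by rewrite derivSn; apply: (IH n) => //; apply: dvdp_exp_deriv.
have -> : p = \sum_(i < size p) p^`N(i).[x]%:P * ('X - x%:P) ^+ i.
  have := nderiv_taylor (map_poly polyC p) (mulrC x%:P ('X - x%:P)).
  rewrite addrC subrK; rewrite -/(comp_poly 'X p) comp_polyXr => {1}->.
  rewrite size_map_polyC; apply: eq_bigr => i _.
  by rewrite nderivn_map horner_map.
apply: (big_ind (dvdp _)) => [|u v|i _]; [exact: dvdp0|exact: dvdp_add|].
have [ltin|leni] := ltnP i n; last first.
  by rewrite dvdp_mull// -(subnK leni) exprD dvdp_mull.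
have := p0 _ ltin; rewrite nderivn_def hornerMn => /eqP.
rewrite mulrn_eq0 eqn0Ngt fact_gt0/= => /eqP ->.
by rewrite mul0r dvdp0.
Qed.

End MultipleRoots.

(** * Antiderivatives and integrals of polynomials *)

Lemma ex_antideriv (R : numFieldType) (p : {poly R}) : exists P, P^`() = p.
Proof.
exists (\poly_(i < (size p).+1) (p`_i.-1 / i%:R)).
apply/polyP => i; rewrite coef_deriv coef_poly ltnS.
case: ltnP => [_|/leq_sizeP/(_ _ (leqnn _)) ->]; last by rewrite mul0rn.
by rewrite -[LHS]mulr_natr divfK// pnatr_eq0.
Qed.

Lemma Rintegral_poly (R : realType) (a b : R) (p P : {poly R}) (f : R -> R) :
  a < b -> P^`() = p -> (forall t, f t = p.[t]) ->
  \int[lebesgue_measure]_(t in `[a, b]) f t = P.[b] - P.[a].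
Proof.
move=> ab <- fP; rewrite /Rintegral.
have -> : f = horner P^`() by apply/funext.
rewrite (@continuous_FTC2 _ _ (horner P))//.
- by apply: continuous_subspaceT => x; exact: continuous_horner.
- split.
  + by move=> x _; exact: derivable_horner.
  + by apply: cvg_at_right_filter; exact: continuous_horner.
  + by apply: cvg_at_left_filter; exact: continuous_horner.
- by move=> x _; rewrite -derivE.
Qed.

(** * The node polynomial of the quadrature rule *)

Section NodePolynomial.
Context {R : realType}.
Variables (r k : nat) (that : 'I_(r - k) -> R).

(** Up to normalization, the weight of the Jacobi polynomial times the Jacobi
polynomial: the monic polynomial that has the interpolation points as
its roots, with their multiplicities. *)
Definition node_poly : {poly R} :=
  ('X - (-1)%:P) ^+ nleft k * ('X - 1%:P) ^+ (k./2).+1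
  * \prod_(z <- [seq that j | j <- enum 'I_(r - k)]) ('X - z%:P).

Lemma size_node_poly : (k <= r)%N -> size node_poly = r.+2.
Proof.
move=> kr; rewrite /node_poly size_monicM ?monic_neq0 ?monic_prod_XsubC//; last first.
  by rewrite monicMl ?monic_exp ?monicXsubC.
rewrite size_monicM ?monic_exp ?monicXsubC// ?monic_neq0 ?monic_exp ?monicXsubC//.
rewrite !size_exp_XsubC size_prod_XsubC size_map size_enum_ord /nleft.
rewrite uphalf_half; have := odd_double_half k; lia.
Qed.

Lemma node_poly_monic : node_poly \is monic.
Proof. by rewrite !monicMl ?monic_exp ?monicXsubC ?monic_prod_XsubC. Qed.

Lemma node_poly_neq0 : node_poly != 0.
Proof. exact/monic_neq0/node_poly_monic. Qed.

Hypothesis zeros : jacobi_zeros that.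

Lemma that_inj : injective that.
Proof.
case: zeros => _ [lt_that _] i j e; apply/val_inj/eqP.
by case: (ltngtP (val i) (val j)) => // /lt_that; rewrite e ltxx.
Qed.

Lemma uniq_that : uniq_roots [seq that j | j <- enum 'I_(r - k)].
Proof. by rewrite uniq_rootsE map_inj_uniq ?enum_uniq//; exact: that_inj. Qed.

(** The three factors of the node polynomial are pairwise coprime, since the
inner nodes are distinct and lie strictly between -1 and 1. *)
Lemma dvd_node_poly (p : {poly R}) :
  (forall i, (i < nleft k)%N -> p^`(i).[-1] = 0) ->
  (forall i, (i <= k./2)%N -> p^`(i).[1] = 0) ->
  (forall j, p.[that j] = 0) -> node_poly %| p.
Proof.
case: zeros => [that1 _] pl pr pm.
have cop (c : R) q : q.[c] != 0 -> forall n, coprimep q (('X - c%:P) ^+ n).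
  by move=> qc n; rewrite coprimep_expr// coprimep_XsubC.
rewrite /node_poly Gauss_dvdp; last first.
  rewrite coprimep_sym coprimepMr !cop//.
    rewrite horner_prod prodf_seq_neq0; apply/allP => _ /mapP[j _ ->] /=.
    by rewrite hornerXsubC subr_eq0; have /andP[_ /lt_eqF] := that1 j; rewrite eq_sym => ->.
  rewrite horner_prod prodf_seq_neq0; apply/allP => _ /mapP[j _ ->] /=.
  by rewrite hornerXsubC subr_eq0; have /andP[/lt_eqF -> _] := that1 j.
rewrite Gauss_dvdp ?cop//; last first.
  by rewrite horner_exp hornerXsubC expf_neq0// opprK pnatr_eq0.
apply/andP; split; first (apply/andP; split).
- exact/dvdp_exp_derivn.
- by apply/dvdp_exp_derivn => i; rewrite ltnS; exact: pr.
- apply: uniq_roots_dvdp uniq_that.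
  by apply/allP => _ /mapP[j _ ->]; apply/rootP.
Qed.

Lemma node_poly_dvd (p : {poly R}) : node_poly %| p ->
  [/\ (forall i, (i < nleft k)%N -> p^`(i).[-1] = 0),
      (forall i, (i <= k./2)%N -> p^`(i).[1] = 0) &
      (forall j, p.[that j] = 0)].
Proof.
move=> dp; split=> [||j].
- apply/dvdp_exp_derivn; apply: dvdp_trans dp.
  by rewrite /node_poly -mulrA dvdp_mulr.
- move=> i; rewrite -ltnS; move: i; apply/dvdp_exp_derivn.
  apply: dvdp_trans dp.
  by rewrite /node_poly mulrAC dvdp_mull.
- apply/rootP; rewrite -dvdp_XsubCl; apply: dvdp_trans dp.
  rewrite /node_poly dvdp_mull// dvdp_XsubCl root_prod_XsubC map_f//.
  by rewrite mem_enum.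
Qed.

(** The Jacobi polynomial is determined up to a factor by its [r - k] distinct
roots, so the node polynomial is proportional to weight times Jacobi
polynomial and inherits its orthogonality.  The integral of
[node_poly * q] over [-1, 1] is written as an increment of an antiderivative. *)
Lemma node_poly_orth (q S : {poly R}) :
  (size q <= r - k)%N -> S^`() = node_poly * q -> S.[1] = S.[-1].
Proof.
move=> sq dS; case: zeros => _ [_ [J [[sJ orthJ] rootJ]]].
have JE : J = lead_coef J *: \prod_(z <- [seq that j | j <- enum 'I_(r - k)]) ('X - z%:P).
  apply: all_roots_prod_XsubC => //.
  - by rewrite size_map size_enum_ord.
  - by apply/allP => _ /mapP[j _ ->]; exact: rootJ.
  - exact: uniq_that.
have J0 : lead_coef J != 0 by rewrite lead_coef_eq0 -size_poly_eq0 sJ.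
(* the sign turns the factor 1 - s of the weight into the monic s - 1 *)
set c := (-1) ^+ (k./2).+1 * lead_coef J.
have c0 : c != 0 by rewrite mulf_neq0// signr_eq0.
have := orthJ _ sq.
rewrite (@Rintegral_poly _ _ _ (c *: (node_poly * q)) (c *: S)) ?derivZ ?dS//.
- by rewrite !hornerZ -mulrBr => /eqP; rewrite mulf_eq0 (negPf c0)/= subr_eq0 => /eqP.
- move=> t; rewrite {1}JE /node_poly !(hornerM, hornerZ, horner_exp, hornerXsubC).
  rewrite /c opprK [1 + t]addrC.
  have -> : (1 - t) ^+ (k./2).+1 = (-1) ^+ (k./2).+1 * (t - 1) ^+ (k./2).+1.
    by rewrite -exprMn mulN1r opprB.
  by ring.
Qed.

End NodePolynomial.

(** * One-sided derivatives of polynomials, affine changes of variable *)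

Section OneSidedPoly.
Context {R : realType}.

Lemma derive1n_horner (p : {poly R}) i : derive1n i (horner p) = horner p^`(i).
Proof. by elim: i => [//|i IH]; rewrite derive1nS IH derivnS derivE. Qed.

Lemma dminus_horner (p : {poly R}) i x : dminus i (horner p) x = p^`(i).[x].
Proof.
rewrite /dminus derive1n_horner; apply: cvg_lim => //.
by apply: cvg_at_left_filter; exact: continuous_horner.
Qed.

Lemma dplus_horner (p : {poly R}) i x : dplus i (horner p) x = p^`(i).[x].
Proof.
rewrite /dplus derive1n_horner; apply: cvg_lim => //.
by apply: cvg_at_right_filter; exact: continuous_horner.
Qed.

End OneSidedPoly.

Section AffineMaps.
Context {R : realType}.
Variables a b : R.
Hypothesis ab : a < b.

Definition from_ref_poly : {poly R} := ((b - a) / 2) *: 'X + ((a + b) / 2)%:P.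
Definition to_ref_poly : {poly R} := (2 / (b - a)) *: 'X - ((a + b) / (b - a))%:P.

Let ba0 : b - a != 0. Proof. by rewrite subr_eq0 gt_eqF. Qed.

Lemma horner_from_ref_poly s : from_ref_poly.[s] = from_ref a b s.
Proof. by rewrite !hornerE /from_ref; field. Qed.

Lemma horner_to_ref_poly t : to_ref_poly.[t] = to_ref a b t.
Proof. by rewrite !hornerE /to_ref; field; rewrite ba0. Qed.

Lemma from_refN1 : from_ref a b (-1) = a. Proof. by rewrite /from_ref; field. Qed.
Lemma from_ref1 : from_ref a b 1 = b. Proof. by rewrite /from_ref; field. Qed.
Lemma to_ref_a : to_ref a b a = -1.
Proof. by rewrite /to_ref; field; rewrite ba0. Qed.
Lemma to_ref_b : to_ref a b b = 1.
Proof. by rewrite /to_ref; field; rewrite ba0. Qed.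
Lemma from_refK : cancel (from_ref a b) (to_ref a b).
Proof. by move=> s; rewrite /from_ref /to_ref; field; rewrite ba0. Qed.

Lemma deriv_from_ref_poly : from_ref_poly^`() = ((b - a) / 2)%:P.
Proof. by rewrite derivD derivZ derivX derivC addr0 alg_polyC. Qed.

Lemma deriv_to_ref_poly : to_ref_poly^`() = (2 / (b - a))%:P.
Proof. by rewrite derivB derivZ derivX derivC subr0 alg_polyC. Qed.

Lemma size_from_ref_poly : size from_ref_poly = 2.
Proof.
by rewrite size_polyDl size_scale ?mulf_neq0 ?invr_neq0 ?pnatr_eq0// size_polyX//
   size_polyC; case: (_ != 0).
Qed.

Lemma size_to_ref_poly : size to_ref_poly = 2.
Proof.
by rewrite size_polyDl size_scale ?mulf_neq0 ?invr_neq0 ?pnatr_eq0// size_polyX//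
   size_polyN size_polyC; case: (_ != 0).
Qed.

Lemma from_ref_polyK : from_ref_poly \Po to_ref_poly = 'X.
Proof.
rewrite comp_polyD comp_polyZ comp_polyX comp_polyC scalerBr scalerA.
rewrite -addrA scale_polyC -polyCN -polyCD.
have -> : - ((b - a) / 2 * ((a + b) / (b - a))) + (a + b) / 2 = 0.
  by field; rewrite ba0.
have -> : (b - a) / 2 * (2 / (b - a)) = 1 by field; rewrite ba0.
by rewrite scale1r addr0.
Qed.

End AffineMaps.

(** * Exactness of the quadrature rule *)

Section Quadrature.
Context {R : realType}.
Variables (r k : nat) (that : 'I_(r - k) -> R).
Hypotheses (kr : (k <= r)%N) (zeros : jacobi_zeros that).

(** Division with remainder by the node polynomial performs Hermite
interpolation: the discarded multiple has zero data.  The interpolant is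
unique because a nonzero polynomial of degree at most [r] is not divisible by
the node polynomial, of degree [r + 1]. *)
Lemma hermite_modp (f : R -> R) (q : {poly R}) :
  (forall i, (i < nleft k)%N -> dplus i f (-1) = q^`(i).[-1]) ->
  (forall i, (i <= k./2)%N -> dminus i f 1 = q^`(i).[1]) ->
  (forall j, f (that j) = q.[that j]) ->
  hermite that f = q %% node_poly that.
Proof.
move=> fl fr fm; rewrite /hermite.
apply: xget_subset1 => /=.
  have [ql qr qm] : [/\ (forall i, (i < nleft k)%N -> (q - q %% node_poly that)^`(i).[-1] = 0),
      (forall i, (i <= k./2)%N -> (q - q %% node_poly that)^`(i).[1] = 0) &
      (forall j, (q - q %% node_poly that).[that j] = 0)].
    by apply: node_poly_dvd; rewrite {1}(divp_eq q (node_poly that)) addrK dvdp_mull.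
  split=> [|i ik|i ik|j].
  - by rewrite -ltnS -(size_node_poly that kr) ltn_modp node_poly_neq0.
  - by rewrite fl//; apply/esym/eqP; rewrite -subr_eq0 -hornerN -hornerD -derivnB ql.
  - by rewrite fr//; apply/esym/eqP; rewrite -subr_eq0 -hornerN -hornerD -derivnB qr.
  - by rewrite fm//; apply/esym/eqP; rewrite -subr_eq0 -hornerN -hornerD qm.
move=> p1 p2 [s1 l1 r1 m1] [s2 l2 r2 m2]; apply/eqP; rewrite -subr_eq0.
have : node_poly that %| p1 - p2.
  apply: dvd_node_poly => // i => [ik|ik|].
  - by rewrite derivnB hornerD hornerN l1// l2// subrr.
  - by rewrite derivnB hornerD hornerN r1// r2// subrr.
  - by rewrite hornerD hornerN m1 m2 subrr.
apply: contraTT => p0; apply/negP => /(dvdp_leq p0).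
rewrite size_node_poly// leqNgt ltnS (leq_trans (size_polyD _ _))//.
by rewrite size_polyN geq_max s1 s2.
Qed.

(** On the reference interval the interpolation error of a polynomial of degree
at most [2r - k] is [node_poly * s] with [s] of degree below [r - k], hence
of zero mean by orthogonality. *)
Lemma quad_poly (a b : R) (p P : {poly R}) (f : R -> R) : a < b ->
  (forall t, f t = p.[t]) -> (size p <= (2 * r - k).+1)%N -> P^`() = p ->
  quad that a b f = P.[b] - P.[a].
Proof.
move=> ab fp sp dP; set N := node_poly that.
set q := p \Po from_ref_poly a b.
have -> : f = horner p by apply/funext.
have herE : hermite that (horner p \o from_ref a b) = q %% N.
  have -> : horner p \o from_ref a b = horner q.
    by apply/funext => s /=; rewrite horner_comp horner_from_ref_poly.
  by apply: hermite_modp => // i _; [exact: dplus_horner|exact: dminus_horner].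
have [S dS] := ex_antideriv (N * (q %/ N)).
have S1 : S.[1] = S.[-1].
  apply: (node_poly_orth zeros _ dS).
  rewrite size_divp ?node_poly_neq0// size_node_poly//.
  rewrite size_comp_poly2 ?size_from_ref_poly//; move: (size p) sp => n. lia.
set h := (b - a) / 2.
have h0 : h != 0 by rewrite mulf_neq0 ?invr_neq0 ?pnatr_eq0 ?subr_eq0 ?gt_eqF.
(* [Q] is an antiderivative of the interpolant, with the same increment as
   the pulled back [P] because that of [S] is zero *)
set Q := h^-1 *: (P \Po from_ref_poly a b) - S.
have dQ : Q^`() = q %% N.
  rewrite derivB derivZ deriv_comp dP deriv_from_ref_poly dS.
  rewrite mulrC mul_polyC scalerA mulVf// scale1r -/q.
  by rewrite {1}(divp_eq q N) mulrC addrAC subrr add0r.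
rewrite /quad (@Rintegral_poly _ _ _ ((q %% N) \Po to_ref_poly a b)
  (h *: (Q \Po to_ref_poly a b)))//.
- rewrite !hornerZ !horner_comp !horner_to_ref_poly// to_ref_a// to_ref_b//.
  rewrite !hornerD !hornerZ !hornerN !horner_comp !horner_from_ref_poly.
  rewrite from_refN1 from_ref1 S1.
  by field.
- rewrite derivZ deriv_comp dQ deriv_to_ref_poly mulrC mul_polyC scalerA.
  have -> : h * (2 / (b - a)) = 1 by rewrite /h; field; rewrite subr_eq0 gt_eqF.
  by rewrite scale1r.
- by move=> t; rewrite /interp herE horner_comp horner_to_ref_poly.
Qed.

End Quadrature.

(** * One-sided jets *)

Section CommonJets.
Context {R : realType}.
Variables (a b : R) (G : set_system R).
Context {GF : ProperFilter G}.
Hypothesis Gab : \forall s \near G, a < s < b.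

(** Here [G] stands for the left neighbourhoods of [b] or the right ones of [a]:
[f] and [g] have the same one-sided [n]-jet there.  Descending through
explicit derivatives makes closure under sums, products and compositions a
plain induction, without the Leibniz and Faa di Bruno formulas.  The relation
is not reflexive: [eqjet n f f] says that [f] has an [n]-jet. *)
Fixpoint eqjet n (f g : R -> R) : Prop :=
  (exists l : R, f @ G --> l /\ g @ G --> l) /\
  (if n is m.+1 then
     exists f' g' : R -> R,
       [/\ forall s, a < s < b -> is_derive s 1 f (f' s),
           forall s, a < s < b -> is_derive s 1 g (g' s) & eqjet m f' g']
   else True).

Lemma eqjetC n f g : eqjet n f g -> eqjet n g f.
Proof.
elim: n f g => [|n IH] f g [[l [fl gl]] h] /=; split; [by exists l|by []|by exists l|].
by move: h => [f' [g' [df dg /IH]]]; exists g', f'.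
Qed.

Lemma eqjetll n f g : eqjet n f g -> eqjet n f f.
Proof.
elim: n f g => [|n IH] f g [[l [fl gl]] h] /=; split; [by exists l|by []|by exists l|].
by move: h => [f' [g' [df dg /IH]]]; exists f', f'.
Qed.

Lemma eqjet_le n m f g : (m <= n)%N -> eqjet n f g -> eqjet m f g.
Proof.
elim: m n f g => [|m IH] [|n] f g //= mn [fgl h]; split=> //.
by move: h => [f' [g' [df dg /(IH _ _ _ mn)]]]; exists f', g'.
Qed.

Lemma eqjetD n f1 f2 g1 g2 : eqjet n f1 g1 -> eqjet n f2 g2 ->
  eqjet n (f1 + f2) (g1 + g2).
Proof.
elim: n f1 f2 g1 g2 => [|n IH] f1 f2 g1 g2 /= [[l [fl gl]] h] [[l' [fl' gl']] h'];
  (split; first by exists (l + l'); split; apply: cvgD) => //.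
move: h h' => [f1' [g1' [df1 dg1 J1]]] [f2' [g2' [df2 dg2 J2]]].
exists (f1' + f2'), (g1' + g2'); split; last exact: IH.
- by move=> s sab; have := df1 s sab; have := df2 s sab => ? ?; exact: is_deriveD.
- by move=> s sab; have := dg1 s sab; have := dg2 s sab => ? ?; exact: is_deriveD.
Qed.

Lemma eqjetM n f1 f2 g1 g2 : eqjet n f1 g1 -> eqjet n f2 g2 ->
  eqjet n (f1 * f2) (g1 * g2).
Proof.
elim: n f1 f2 g1 g2 => [|n IH] f1 f2 g1 g2 J1 J2;
  have [[l [fl gl]] h] := J1; have [[l' [fl' gl']] h'] := J2;
  (split; first by exists (l * l'); split; apply: cvgM) => //.
move: h h' => [f1' [g1' [df1 dg1 J1']]] [f2' [g2' [df2 dg2 J2']]].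
exists (f1 * f2' + f2 * f1'), (g1 * g2' + g2 * g1'); split.
- by move=> s sab; have := df1 s sab; have := df2 s sab => ? ?; exact: is_deriveM.
- by move=> s sab; have := dg1 s sab; have := dg2 s sab => ? ?; exact: is_deriveM.
- by apply: eqjetD; apply: IH => //; apply: eqjet_le (leqnSn n) _.
Qed.

Lemma eqjet_cst n (c : R) : eqjet n (cst c) (cst c).
Proof.
elim: n c => [|n IH] c; split=> //; try by exists c; split; exact: cvg_cst.
by exists (cst 0), (cst 0); split=> // s _; exact: is_derive_cst.
Qed.

Lemma eqjet_sum n (I : Type) (s : seq I) (f g : I -> R -> R) :
  (forall i, eqjet n (f i) (g i)) ->
  eqjet n (fun t => \sum_(i <- s) f i t) (fun t => \sum_(i <- s) g i t).
Proof.
move=> J; rewrite -!fct_sumE.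
apply: (big_ind2 (eqjet n)) => // [|f1 g1 f2 g2 J1 J2].
  exact: eqjet_cst.
exact: eqjetD.
Qed.

Lemma eqjet_horner (x : R) n (p q : {poly R}) : G --> x ->
  (forall i, (i <= n)%N -> p^`(i).[x] = q^`(i).[x]) ->
  eqjet n (horner p) (horner q).
Proof.
move=> Gx; have cvgp (p0 : {poly R}) : horner p0 @ G --> p0.[x].
  by apply: (cvg_comp _ _ Gx); exact: continuous_horner.
elim: n p q => [|n IH] p q pq;
  (split; first by exists p.[x]; split; rewrite // [p.[x]](pq 0%N)) => //.
exists (horner p^`()), (horner q^`()); split; try by move=> s _; exact: is_derive_poly.
by apply: IH => i ik; rewrite -!derivSn pq.
Qed.

Lemma near_itv_oo (s : R) : a < s < b -> \forall t \near s, a < t < b.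
Proof.
move=> /andP[sa sb]; near=> t; apply/andP; split.
- by near: t; exact: lt_nbhsr.
- by near: t; exact: lt_nbhsl.
Unshelve. all: by end_near. Qed.

Lemma eq_derive1n (V : normedModType R) (f g : R -> V) i :
  (forall s, a < s < b -> f s = g s) ->
  forall s, a < s < b -> derive1n i f s = derive1n i g s.
Proof.
move=> fg; elim: i => [//|i IH] s sab; rewrite !derive1nS !derive1E.
apply: near_eq_derive.
by apply: filterS (near_itv_oo sab); exact: IH.
Qed.

Lemma near_eq_cvg_to (V : normedModType R) (f g : R -> V) (l : V) :
  (forall s, a < s < b -> f s = g s) -> f @ G --> l -> g @ G --> l.
Proof.
move=> fg; apply: cvg_trans; apply: near_eq_cvg.
by near do apply: fg.
Unshelve. all: by end_near. Qed.

Lemma eqjet_cvg n f g i : eqjet n f g -> (i <= n)%N ->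
  exists l : R, derive1n i f @ G --> l /\ derive1n i g @ G --> l.
Proof.
elim: i n f g => [|i IH] [|n] f g // J; [by case: J|by case: J|].
move=> lin; have [_ [f' [g' [df dg J']]]] := J.
have [l [fl gl]] := IH _ _ _ J' lin; exists l.
by rewrite !derive1Sn; split; [apply: near_eq_cvg_to fl|apply: near_eq_cvg_to gl];
  apply: eq_derive1n => s sab; rewrite derive1E;
  [have := df s sab|have := dg s sab] => ?; rewrite derive_val.
Qed.

Lemma eqjet_derivable n f g i s : eqjet n f g -> (i < n)%N -> a < s < b ->
  derivable (derive1n i f) s 1.
Proof.
move=> J; elim: i n f g J s => [|i IH] [|n] f g // J s lin sab;
  have [_ [f' [g' [df dg J']]]] := J.
  by have := df s sab => -[].
have := IH _ _ _ J' s lin sab; apply: near_eq_derivable.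
apply: filterS (near_itv_oo sab) => t tab; rewrite derive1Sn.
apply: eq_derive1n tab => t' tab'; rewrite derive1E.
by have := df t' tab' => ?; rewrite derive_val.
Qed.

(** Converse of [eqjet_cvg]: two functions that have jets and whose iterated
derivatives have equal limits have the same jet. *)
Lemma eqjet_of_lim n f g : eqjet n f f -> eqjet n g g ->
  (forall i, (i <= n)%N -> lim (derive1n i f @ G) = lim (derive1n i g @ G)) ->
  eqjet n f g.
Proof.
have limE (h h' : R -> R) (l : R) : h @ G --> l -> lim (h @ G) = lim (h' @ G) ->
    cvg (h' @ G) -> h' @ G --> l.
  by move=> hl + ch; rewrite (cvg_lim _ hl)// => ->; exact: ch.
elim: n f g => [|n IH] f g Jf Jg fg; have [[l [fl _]] hf] := Jf;
   have [[l' [gl _]] hg] := Jg; (split; [exists l; split => //|] => //).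
- by apply: limE (fg 0%N isT) _ => //; apply/cvg_ex; exists l'.
- by apply: limE (fg 0%N isT) _ => //; apply/cvg_ex; exists l'.
move: hf hg => [f' [f2 [df _ /eqjetll Jf']]] [g' [g2 [dg _ /eqjetll Jg']]].
exists f', g'; split=> //; apply: IH => // i lin.
have := fg i.+1 lin; rewrite !derive1Sn.
have [lf [flf _]] := eqjet_cvg Jf' lin; have [lg [glg _]] := eqjet_cvg Jg' lin.
have df' s : a < s < b -> f' s = f^`()%classic s.
  by move=> sab; rewrite derive1E; have := df s sab => ?; rewrite derive_val.
have dg' s : a < s < b -> g' s = g^`()%classic s.
  by move=> sab; rewrite derive1E; have := dg s sab => ?; rewrite derive_val.
rewrite (cvg_lim _ flf)// (cvg_lim _ glg)//.
rewrite (cvg_lim _ (near_eq_cvg_to (eq_derive1n i df') flf))//.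
by rewrite (cvg_lim _ (near_eq_cvg_to (eq_derive1n i dg') glg)).
Qed.

Lemma cvg_col (d : nat) (f : R -> 'cV[R]_d) (l : 'cV[R]_d) :
  (forall j, (fun t => f t j 0) @ G --> l j 0) -> f @ G --> l.
Proof.
move=> fl; apply/cvgrPdist_le => /= e e0; near=> x.
rewrite /Num.Def.normr/= mx_normrE (bigmax_le _ (ltW e0))//= => -[i j] _.
rewrite !mxE/= ord1; move: i; near: x; apply: filter_forall => i.
exact: ((cvgrPdist_le _ _).1 (fl i)).
Unshelve. all: by end_near. Qed.

Lemma derive1n_col (d : nat) n (f g : R -> 'cV[R]_d) i :
  (forall j, eqjet n (fun t => f t j 0) (fun t => g t j 0)) -> (i <= n)%N ->
  forall s, a < s < b ->
  derive1n i f s = \col_j derive1n i (fun t => f t j 0) s.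
Proof.
move=> J; elim: i => [|i IH] lin s sab; first by apply/colP => j; rewrite mxE.
rewrite derive1nS derive1E.
rewrite (@near_eq_derive _ _ _ _ (fun t => \col_j derive1n i (fun t => f t j 0) t)).
- rewrite derive_mx; last first.
    apply/derivable_mxP => j j'.
    have -> : (fun x : R => (\col_j0 derive1n i (fun t => f t j0 0) x) j j') =
       derive1n i (fun t => f t j 0) by apply/funext => x; rewrite mxE.
    exact: eqjet_derivable (J j) lin sab.
  apply/colP => j; rewrite !mxE derive1nS derive1E; congr ('D_1 _ s).
  by apply/funext => x; rewrite mxE.
- by apply: filterS (near_itv_oo sab) => t; apply: IH; exact: ltnW.
Qed.

(** One-sided derivatives of vector functions are taken componentwise.  The
iterated derivative of a vector function is only controlled where its
components are differentiable, hence the passage through jets. *)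
Lemma lim_derive1n_col (d : nat) n (f g : R -> 'cV[R]_d) i j :
  (forall j, eqjet n (fun t => f t j 0) (fun t => g t j 0)) -> (i <= n)%N ->
  lim (derive1n i f @ G) j 0 = lim (derive1n i (fun t => f t j 0) @ G).
Proof.
move=> J lin; suff : derive1n i f @ G --> \col_j lim (derive1n i (fun t => f t j 0) @ G).
  by move=> /cvg_lim ->//; rewrite mxE.
apply: cvg_col => j'; rewrite mxE.
have [l [fl _]] := eqjet_cvg (J j') lin.
have -> : lim (derive1n i (fun t => f t j' 0) @ G) = l by apply: cvg_lim.
apply: near_eq_cvg_to fl => s sab.
by rewrite (derive1n_col J lin sab) mxE.
Qed.

Lemma eqjet_lim_col (d : nat) n (f g : R -> 'cV[R]_d) i :
  (forall j, eqjet n (fun t => f t j 0) (fun t => g t j 0)) -> (i <= n)%N ->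
  lim (derive1n i f @ G) = lim (derive1n i g @ G).
Proof.
move=> J lin; apply/colP => j; rewrite (lim_derive1n_col _ J)//.
have J' j' := eqjetC (J j'); rewrite (lim_derive1n_col _ J')//.
have [l [fl gl]] := eqjet_cvg (J j) lin.
by rewrite (cvg_lim _ fl)// (cvg_lim _ gl).
Qed.

End CommonJets.

(** * Chain rules for jets *)

Lemma is_derive_comp1 (R : realType) (f g : R -> R) (x df dg : R) :
  is_derive x 1 f df -> is_derive (f x) 1 g dg -> is_derive x 1 (g \o f) (dg * df).
Proof.
move=> hf hg; apply: DeriveDef.
  apply/derivable1_diffP/differentiable_comp; exact/derivable1_diffP/ex_derive.
rewrite -derive1E derive1_comp; [|exact: ex_derive|exact: ex_derive].
by rewrite !derive1E !derive_val.
Qed.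

Lemma eqjet_comp_affine (R : realType) (a b a' b' c e : R) (G G' : set_system R)
    {FG : ProperFilter G} {FG' : ProperFilter G'} n f g :
  (forall s, a' < s < b' -> a < c * s + e < b) ->
  (fun s : R => c * s + e) @ G' --> G ->
  eqjet a b G n f g ->
  eqjet a' b' G' n (f \o (fun s => c * s + e)) (g \o (fun s => c * s + e)).
Proof.
move=> phiab phiG; elim: n f g => [|n IH] f g [[l [fl gl]] h];
  (split; first by exists l; split; [exact: cvg_comp fl|exact: cvg_comp gl]) => //.
have dphi (s : R) : is_derive s (1 : R) (fun s : R => c * s + e) c.
  rewrite -[X in is_derive _ _ X _]/((fun s : R => c *: id s) + cst e).
  by apply: is_derive_eq; rewrite addr0 [_ *: _]mulr1.
move: h => [f' [g' [df dg J]]].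
exists ((f' \o (fun s => c * s + e)) * cst c), ((g' \o (fun s => c * s + e)) * cst c).
split.
- by move=> s /phiab sab; apply: is_derive_comp1 => //; exact: df.
- by move=> s /phiab sab; apply: is_derive_comp1 => //; exact: dg.
- by apply: eqjetM; [exact: IH|exact: eqjet_cst].
Qed.

Section Slab.
Context {R : realType} {d : nat}.
Implicit Types (Gf : R * 'cV[R]_d -> 'cV[R]_d) (p q : 'cV[{poly R}]_d).

Lemma is_derive_peval p t : is_derive t (1 : R) (peval 0 p) (peval 1 p t).
Proof.
have dp j : is_derive t (1 : R) (fun x => peval 0 p x j 0) (peval 1 p t j 0).
  rewrite mxE derivn1; have -> : (fun x => peval 0 p x j 0) = horner (p j 0).
    by apply/funext => x; rewrite mxE.
  exact: is_derive_poly.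
have dvb : derivable (peval 0 p) t (1 : R).
  by apply/derivable_mxP => j j'; rewrite ord1; case: (dp j).
apply: DeriveDef => //.
by rewrite derive_mx//; apply/colP => j; rewrite mxE; have := dp j => ?; rewrite derive_val.
Qed.

Lemma continuous_peval p t : {for t, continuous (peval 0 p)}.
Proof.
apply/differentiable_continuous/derivable1_diffP.
by case: (is_derive_peval p t).
Qed.

(** The differential is evaluated at [(1, p'(t))], split along the time direction
and the coordinate directions: only directional derivatives in fixed
directions appear, which are those that [Cn_slab] controls. *)
Lemma is_derive_along Gf p t j : differentiable Gf (t, peval 0 p t) ->
  is_derive t (1 : R) (fun s => Gf (s, peval 0 p s) j 0)
   ('D_((1 : R), 0) Gf (t, peval 0 p t) j 0
    + \sum_(i < d) peval 1 p t i 0 * 'D_(0, delta_mx i 0) Gf (t, peval 0 p t) j 0).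
Proof.
move=> dG; pose gam s := (s, peval 0 p s).
have dp : differentiable (peval 0 p) t.
  by apply/derivable1_diffP; case: (is_derive_peval p t).
have dgam : differentiable gam t by apply: differentiable_pair.
have dGg : differentiable (Gf \o gam) t by apply: differentiable_comp.
have dvb : derivable (Gf \o gam) t (1 : R) by exact/derivable1_diffP.
have dvbj := (derivable_mxP _ _ _).1 dvb j 0.
apply: DeriveDef => //.
have -> : 'D_1 (fun s => Gf (s, peval 0 p s) j 0) t = ('D_1 (Gf \o gam) t) j 0.
  by rewrite derive_mx// mxE.
rewrite deriveE// diff_comp//= diff_pair//=.
rewrite -(@deriveE _ _ _ id)// derive_id.
rewrite -(deriveE _ dp); have := is_derive_peval p t => ?; rewrite derive_val.
have {1}-> : peval 1 p t = \sum_(i < d) peval 1 p t i 0 *: delta_mx i 0.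
  by rewrite {1}[peval 1 p t]matrix_sum_delta; apply: eq_bigr => i _; rewrite big_ord1.
have -> : ((1 : R), \sum_(i < d) peval 1 p t i 0 *: delta_mx i 0) =
    ((1 : R), 0) + \sum_(i < d) peval 1 p t i 0 *: ((0 : R), delta_mx i (0 : 'I_1)).
  apply: injective_projections => /=.
    rewrite (big_morph fst (id1 := 0) (op1 := +%R))// big1 ?addr0// => i _.
    by rewrite /= scaler0.
  by rewrite (big_morph snd (id1 := 0) (op1 := +%R))// add0r.
rewrite linearD linear_sum !mxE summxE deriveE//; congr (_ + _).
by apply: eq_bigr => i _; rewrite linearZ mxE deriveE.
Qed.

Lemma cvg_slab (a b : R) Gf (G : set_system R) {FG : ProperFilter G} p x :
  {within `[a, b] `*` [set: 'cV[R]_d], continuous Gf} ->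
  (\forall s \near G, a < s < b) -> a <= x <= b -> G --> x ->
  (fun s => Gf (s, peval 0 p s)) @ G --> Gf (x, peval 0 p x).
Proof.
move=> /subspace_continuousP cG Gab xab Gx.
have xA : (`[a, b] `*` [set: 'cV[R]_d]) (x, peval 0 p x).
  by split=> //=; rewrite in_itv.
have hp : peval 0 p @ G --> peval 0 p x.
  exact: (continuous_cvg (f := id) _ (@continuous_peval p x) Gx).
have cgam : (fun s => (s, peval 0 p s)) @ G --> (x, peval 0 p x).
  exact: (cvg_pair (f := id) Gx hp).
suff cw : (fun s => (s, peval 0 p s)) @ G -->
    within (`[a, b] `*` [set: 'cV[R]_d]) (nbhs (x, peval 0 p x)).
  exact: (cvg_comp _ _ cw (cG _ xA)).
move=> B wB.
have {}wB : \forall s \near G, (`[a, b] `*` [set: 'cV[R]_d]) (s, peval 0 p s) ->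
    B (s, peval 0 p s) by exact: (cgam _ wB).
suff : \forall s \near G, B (s, peval 0 p s) by [].
apply: filterS2 wB Gab => s + /andP[sa sb]; apply; split=> //=.
by rewrite in_itv/= !ltW.
Qed.

(** Only the [n]-jet of [p] at [x] enters the [n]-jet of [t |-> Gf (t, p t)].
By the chain rule its derivative is a sum of products of components of [p']
with functions of the same form built from directional derivatives of [Gf],
to which the induction hypothesis applies. *)
Lemma eqjet_slab (t0 t1 a b x : R) (G : set_system R) {FG : ProperFilter G} n m Gf p q j :
  t0 <= a -> b <= t1 -> a <= x <= b -> (\forall s \near G, a < s < b) -> G --> x ->
  (n <= m)%N -> Cn_slab t0 t1 m Gf ->
  (forall i, (i <= n)%N -> peval i p x = peval i q x) ->
  eqjet a b G n (fun t => Gf (t, peval 0 p t) j 0) (fun t => Gf (t, peval 0 q t) j 0).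
Proof.
move=> t0a bt1 /andP[ax xb] Gab Gx.
have wide s : a < s < b -> t0 < s < t1.
  by move=> /andP[sa sb]; rewrite (le_lt_trans t0a)//= (lt_le_trans sb).
have Gt : \forall s \near G, t0 < s < t1 by apply: filterS Gab.
have xt : t0 <= x <= t1 by rewrite (le_trans t0a)//= (le_trans xb).
have cvgG (H : R * 'cV[R]_d -> 'cV[R]_d) p0 :
    {within `[t0, t1] `*` [set: 'cV[R]_d], continuous H} ->
    (fun t => H (t, peval 0 p0 t) j 0) @ G --> H (x, peval 0 p0 x) j 0.
  move=> cH; have hG : (fun t => H (t, peval 0 p0 t)) @ G --> H (x, peval 0 p0 x).
    exact: cvg_slab cH Gt xt Gx.
  exact: (continuous_cvg (h := fun v : 'cV[R]_d => v j 0) _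
    (@coord_continuous _ _ _ j 0 _) hG).
elim: n m Gf => [|n IH] [|m] Gf // nm [cG hG] pq;
  (split; first by exists (Gf (x, peval 0 p x) j 0); split;
     [|rewrite (pq 0%N)//]; exact: cvgG) => //.
case: hG => dG /choice[H HP].
pose D (p0 : 'cV[{poly R}]_d) s := H ((1 : R), 0) (s, peval 0 p0 s) j 0 +
   \sum_(i < d) peval 1 p0 s i 0 * H (0, delta_mx i 0) (s, peval 0 p0 s) j 0.
have dD p0 s : a < s < b -> is_derive s (1 : R) (fun t => Gf (t, peval 0 p0 t) j 0) (D p0 s).
  move=> /wide sab; apply: is_derive_eq; first exact/is_derive_along/dG.
  rewrite /D (HP _).1//; congr (_ + _); apply: eq_bigr => i _.
  by rewrite (HP _).1.
exists (D p), (D q); split; [exact: dD|exact: dD|].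
have pq' i : (i <= n)%N -> peval i p x = peval i q x by move=> lin; apply: pq; exact: ltnW.
apply: eqjetD; first exact: (IH m _ nm (HP _).2 pq').
apply: eqjet_sum => i.
apply: eqjetM; last exact: (IH m _ nm (HP _).2 pq').
have pE (p0 : 'cV[{poly R}]_d) : (fun t => peval 1 p0 t i 0) = horner (p0 i 0)^`().
  by apply/funext => t; rewrite mxE derivn1.
rewrite !pE; apply: eqjet_horner Gx _ => l ln.
by have /colP/(_ i) := pq l.+1 ln; rewrite !mxE -!derivSn.
Qed.


End Slab.

(** * The node polynomial on a mesh interval *)

Lemma derivn_comp_to_ref (R : realType) (a b : R) (p : {poly R}) i :
  (p \Po to_ref_poly a b)^`(i) = (2 / (b - a)) ^+ i *: (p^`(i) \Po to_ref_poly a b).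
Proof.
elim: i => [|i IH]; first by rewrite expr0 scale1r.
rewrite derivnS IH derivZ deriv_comp deriv_to_ref_poly -derivnS.
by rewrite [_ * _%:P]mulrC mul_polyC scalerA exprSr.
Qed.

Section MappedNodePolynomial.
Context {R : realType}.
Variables (r k : nat) (that : 'I_(r - k) -> R) (a b : R).
Hypotheses (kr : (k <= r)%N) (zeros : jacobi_zeros that) (ab : a < b).

Definition mapped_node_poly : {poly R} := node_poly that \Po to_ref_poly a b.

(** Each derivative costs a factor [2 / (b - a)]: the source of the powers of
the step size in the error bound. *)
Lemma horner_derivn_mapped i t :
  mapped_node_poly^`(i).[t]
  = (2 / (b - a)) ^+ i * (node_poly that)^`(i).[to_ref a b t].
Proof.
by rewrite derivn_comp_to_ref hornerZ horner_comp horner_to_ref_poly.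
Qed.

Lemma mapped_node_poly_zeros :
  [/\ (forall i, (i < nleft k)%N -> mapped_node_poly^`(i).[a] = 0),
      (forall i, (i <= k./2)%N -> mapped_node_poly^`(i).[b] = 0) &
      (forall j, mapped_node_poly.[from_ref a b (that j)] = 0)].
Proof.
have [l0 r0 m0] := node_poly_dvd (dvdpp (node_poly that)).
split=> [i ik|i ik|j].
- by rewrite horner_derivn_mapped to_ref_a// l0// mulr0.
- by rewrite horner_derivn_mapped to_ref_b// r0// mulr0.
- by rewrite -[mapped_node_poly]derivn0 horner_derivn_mapped from_refK// m0 mulr0.
Qed.

Lemma size_mapped_node_poly : size mapped_node_poly = r.+2.
Proof. by rewrite size_comp_poly2 ?size_node_poly// size_to_ref_poly. Qed.

Lemma lead_coef_mapped_node_poly :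
  lead_coef mapped_node_poly = (2 / (b - a)) ^+ r.+1.
Proof.
rewrite lead_coef_comp ?size_to_ref_poly//.
rewrite (monicP (node_poly_monic that)) mul1r size_node_poly//; congr (_ ^+ _).
rewrite lead_coefDl ?lead_coefZ ?lead_coefX ?mulr1//.
rewrite size_polyN size_polyC size_scale ?size_polyX//.
  by case: (_ != 0).
by rewrite mulf_neq0 ?pnatr_eq0// invr_neq0// subr_eq0 gt_eqF.
Qed.

Lemma mapped_node_poly_orth (q : {poly R}) : (size q <= r - k)%N ->
  exists2 S, S^`() = mapped_node_poly * q & S.[a] = S.[b].
Proof.
move=> sq; have [S dS] := ex_antideriv (node_poly that * (q \Po from_ref_poly a b)).
have S1 : S.[1] = S.[-1].
  by apply: (node_poly_orth zeros _ dS); rewrite size_comp_poly2 ?size_from_ref_poly.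
exists (((b - a) / 2) *: (S \Po to_ref_poly a b)).
  rewrite derivZ deriv_comp dS deriv_to_ref_poly comp_polyM -comp_polyA.
  rewrite from_ref_polyK// comp_polyXr [_ * _%:P]mulrC mul_polyC scalerA.
  have -> : (b - a) / 2 * (2 / (b - a)) = 1 by field; rewrite subr_eq0 gt_eqF.
  by rewrite scale1r.
by rewrite !hornerZ !horner_comp !horner_to_ref_poly// to_ref_a// to_ref_b// S1.
Qed.

(** The quadrature rule sees a function only through its Hermite data. *)
Lemma quad_eq (f g : R -> R) :
  (forall i, (i < nleft k)%N ->
     dplus i (f \o from_ref a b) (-1) = dplus i (g \o from_ref a b) (-1)) ->
  (forall i, (i <= k./2)%N ->
     dminus i (f \o from_ref a b) 1 = dminus i (g \o from_ref a b) 1) ->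
  (forall j, f (from_ref a b (that j)) = g (from_ref a b (that j))) ->
  quad that a b f = quad that a b g.
Proof.
move=> fgl fgr fgm; rewrite /quad.
suff -> : interp that a b f = interp that a b g by [].
apply/funext => t; rewrite /interp /hermite; congr (horner _ _); congr (xget 0 _).
apply/seteqP; split=> p [sp pl pr pm]; split=> //.
- by move=> i ik; rewrite pl// fgl.
- by move=> i ik; rewrite pr// fgr.
- by move=> j; rewrite pm /= fgm.
- by move=> i ik; rewrite pl// fgl.
- by move=> i ik; rewrite pr// fgr.
- by move=> j; rewrite pm /= fgm.
Qed.

End MappedNodePolynomial.

(** * Transport of jets to the reference interval *)

Lemma near_left_itv (R : realType) (a b : R) : a < b -> \forall s \near b^'-, a < s < b.
Proof.
by move=> ab; near=> s; apply/andP; split; near: s; [exact: nbhs_left_gt|exact: nbhs_left_lt].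
Unshelve. all: by end_near. Qed.

Lemma near_right_itv (R : realType) (a b : R) : a < b -> \forall s \near a^'+, a < s < b.
Proof.
move=> ab; near=> s.
by apply/andP; split; near: s; [exact: nbhs_right_gt|exact: nbhs_right_lt].
Unshelve. all: by end_near. Qed.

Lemma from_ref_oo (R : realType) (a b s : R) : a < b -> -1 < s < 1 ->
  a < (b - a) / 2 * s + (a + b) / 2 < b.
Proof. by move=> ab /andP[s1 s2]; apply/andP; split; nra. Qed.

Lemma from_refE (R : realType) (a b : R) :
  from_ref a b = (fun s => (b - a) / 2 * s + (a + b) / 2).
Proof. by apply/funext => s; rewrite /from_ref; field. Qed.

Lemma from_ref_hornerE (R : realType) (a b : R) :
  from_ref a b = horner (from_ref_poly a b).
Proof. by apply/funext => s; rewrite horner_from_ref_poly. Qed.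

Lemma cvg_from_ref_left (R : realType) (a b : R) : a < b ->
  (fun s => (b - a) / 2 * s + (a + b) / 2) @ (1 : R)^'- --> b^'-.
Proof.
move=> ab; rewrite -from_refE.
have c1 : from_ref a b @ (1 : R)^'- --> b.
  rewrite -[X in _ --> X](from_ref1 a b) from_ref_hornerE.
  by apply: cvg_at_left_filter; exact: continuous_horner.
move=> A hA; have lt1 : (-1 : R) < 1 by lra.
have h : \forall s \near (1 : R)^'-, from_ref a b s < b -> A (from_ref a b s).
  exact: (c1 _ hA).
suff : \forall s \near (1 : R)^'-, A (from_ref a b s) by [].
apply: filterS2 h (near_left_itv lt1) => s + /(from_ref_oo ab)/andP[_ sb].
by apply; rewrite from_refE.
Qed.

Lemma cvg_from_ref_right (R : realType) (a b : R) : a < b ->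
  (fun s => (b - a) / 2 * s + (a + b) / 2) @ (-1 : R)^'+ --> a^'+.
Proof.
move=> ab; rewrite -from_refE.
have c1 : from_ref a b @ (-1 : R)^'+ --> a.
  rewrite -[X in _ --> X](from_refN1 a b) from_ref_hornerE.
  by apply: cvg_at_right_filter; exact: continuous_horner.
move=> A hA; have lt1 : (-1 : R) < 1 by lra.
have h : \forall s \near (-1 : R)^'+, a < from_ref a b s -> A (from_ref a b s).
  exact: (c1 _ hA).
suff : \forall s \near (-1 : R)^'+, A (from_ref a b s) by [].
apply: filterS2 h (near_right_itv lt1) => s + /(from_ref_oo ab)/andP[sb _].
by apply; rewrite from_refE.
Qed.

Lemma dminus_from_ref (R : realType) (a b : R) i (f g : R -> R) : a < b ->
  eqjet a b b^'- i f g ->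
  dminus i (f \o from_ref a b) 1 = dminus i (g \o from_ref a b) 1.
Proof.
move=> ab J; have lt1 : (-1 : R) < 1 by lra.
have J' : eqjet (-1) 1 (1 : R)^'- i (f \o from_ref a b) (g \o from_ref a b).
  rewrite from_refE; apply: eqjet_comp_affine J; last exact: cvg_from_ref_left.
  by move=> s; exact: from_ref_oo.
rewrite /dminus; have [l [l1 l2]] := eqjet_cvg (near_left_itv lt1) J' (leqnn i).
by rewrite (cvg_lim _ l1)// (cvg_lim _ l2).
Qed.

Lemma dplus_from_ref (R : realType) (a b : R) i (f g : R -> R) : a < b ->
  eqjet a b a^'+ i f g ->
  dplus i (f \o from_ref a b) (-1) = dplus i (g \o from_ref a b) (-1).
Proof.
move=> ab J; have lt1 : (-1 : R) < 1 by lra.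
have J' : eqjet (-1) 1 (-1 : R)^'+ i (f \o from_ref a b) (g \o from_ref a b).
  rewrite from_refE; apply: eqjet_comp_affine J; last exact: cvg_from_ref_right.
  by move=> s; exact: from_ref_oo.
rewrite /dplus; have [l [l1 l2]] := eqjet_cvg (near_right_itv lt1) J' (leqnn i).
by rewrite (cvg_lim _ l1)// (cvg_lim _ l2).
Qed.

(** * Jets of the right-hand side of a collocation solution *)

Section MatrixPoly.
Context {R : realType} {d : nat}.
Implicit Types (M : 'M[R]_d) (W V phi : 'cV[{poly R}]_d) (f : R -> 'cV[R]_d).

Definition mulM_deriv M W (j : 'I_d) : {poly R} :=
  \sum_(l < d) M j l *: (W l 0)^`().

(** The integrand [(M W', phi)] of the variational condition, as a polynomial. *)
Definition inner_poly M W phi : {poly R} :=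
  \sum_(j < d) mulM_deriv M W j * phi j 0.

Lemma derivn_mulM_deriv M W j i x :
  (mulM_deriv M W j)^`(i).[x] = (M *m peval i.+1 W x) j 0.
Proof.
rewrite /mulM_deriv (linear_sum (derivn i)) horner_sum mxE; apply: eq_bigr => l _.
by rewrite linearZ hornerZ mxE derivSn.
Qed.

Lemma horner_mulM_deriv M W j x : (mulM_deriv M W j).[x] = (M *m peval 1 W x) j 0.
Proof. by rewrite -derivn_mulM_deriv. Qed.

Lemma horner_inner_poly M W phi x :
  (inner_poly M W phi).[x] = inner (M *m peval 1 W x) (peval 0 phi x).
Proof.
rewrite /inner_poly /inner horner_sum; apply: eq_bigr => j _.
by rewrite hornerM horner_mulM_deriv [peval 0 phi x j 0]mxE.
Qed.

Lemma size_inner_poly M W phi s e : deg_le s.+1 W -> deg_le e phi ->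
  (size (inner_poly M W phi) <= (s + e).+1)%N.
Proof.
move=> sW sphi; apply: (leq_trans (size_sum _ _ _)); apply/bigmax_leqP => j _.
apply: (leq_trans (size_polyMleq _ _)).
have sM : (size (mulM_deriv M W j) <= s.+1)%N.
  apply: (leq_trans (size_sum _ _ _)); apply/bigmax_leqP => l _.
  apply: (leq_trans (size_scale_leq _ _)).
  have := sW l; have [->|W0] := eqVneq (W l 0) 0; first by rewrite deriv0 size_poly0.
  by have := lt_size_deriv W0; lia.
by have := sphi j; lia.
Qed.

Section OneSide.
Variables (F : R -> 'cV[R]_d -> 'cV[R]_d) (M : 'M[R]_d) (W V : 'cV[{poly R}]_d).
Variables (t0 t1 a b x : R) (G : set_system R) (m n : nat).
Context {FG : ProperFilter G}.
Hypotheses (t0a : t0 <= a) (bt1 : b <= t1) (axb : a <= x <= b).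
Hypotheses (Gab : \forall s \near G, a < s < b) (Gx : G --> x).
Hypotheses (nm : (n <= m)%N) (Fsm : Cn_slab t0 t1 m (fun y => F y.1 y.2)).
Hypothesis WV : forall i, (i <= n)%N -> peval i V x = peval i W x.
Let FW t := F t (peval 0 W t).
Let FV t := F t (peval 0 V t).
Hypothesis coll : forall i, (i <= n)%N ->
  M *m peval i.+1 W x = lim (derive1n i FW s @[s --> G]).

Lemma lim_FV i : (i <= n)%N ->
  lim (derive1n i FV s @[s --> G]) = lim (derive1n i FW s @[s --> G]).
Proof.
move=> lin.
have J j : eqjet a b G n (fun t => FV t j 0) (fun t => FW t j 0).
  exact: (eqjet_slab j t0a bt1 axb Gab Gx nm Fsm WV).
exact: (eqjet_lim_col Gab J lin).
Qed.

(** At the end points the collocation conditions say that [F(t, W)] and [M W']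
have the same jet; since the jet of [F(t, V)] depends on [V] only through its
jet, which is that of [W], the two sides can be tested against [phi]. *)
Lemma eqjet_coll phi : eqjet a b G n
  (fun t => inner (FV t) (peval 0 phi t)) (horner (inner_poly M W phi)).
Proof.
have -> : horner (inner_poly M W phi) =
    fun t => \sum_(j < d) (horner (mulM_deriv M W j) * horner (phi j 0)) t.
  apply/funext => t; rewrite horner_sum; apply: eq_bigr => j _.
  by rewrite hornerM.
have -> : (fun t => inner (FV t) (peval 0 phi t)) =
    fun t => \sum_(j < d) ((fun t => FV t j 0) * horner (phi j 0)) t.
  by apply/funext => t; apply: eq_bigr => j _; rewrite mxE.
apply: eqjet_sum => j. apply: eqjetM; last exact: (eqjet_horner a b Gx).
have J i : eqjet a b G n (fun t => FV t i 0) (fun t => FW t i 0).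
  exact: (eqjet_slab i t0a bt1 axb Gab Gx nm Fsm WV).
have JW : eqjet a b G n (horner (mulM_deriv M W j)) (horner (mulM_deriv M W j)).
  exact: (eqjet_horner a b Gx).
apply: (eqjet_of_lim Gab (eqjetll (J j)) JW) => i lin.
have -> : lim (derive1n i (horner (mulM_deriv M W j)) t @[t --> G])
          = (mulM_deriv M W j)^`(i).[x].
  rewrite derive1n_horner; apply: cvg_lim => //.
  exact: (continuous_cvg (f := id) _ (@continuous_horner _ _ x) Gx).
rewrite derivn_mulM_deriv coll// -lim_FV//.
by rewrite (lim_derive1n_col Gab j J lin).
Qed.

End OneSide.
End MatrixPoly.

(** * Lowering the degree of a collocation solution *)

Lemma ltn_nleft_half k i : (i < nleft k)%N -> (i <= k./2)%N.
Proof. by rewrite /nleft uphalf_half; case: (odd k); lia. Qed.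

Section OneInterval.
Context {R : realType} {d : nat}.
Variables (r k : nat) (that : 'I_(r - k) -> R) (a b : R) (M : 'M[R]_d).
Variables (lv : 'cV[R]_d) (W : 'cV[{poly R}]_d).
Hypotheses (kr : (k <= r)%N) (zeros : jacobi_zeros that) (ab : a < b).
Hypothesis degW : deg_le r.+1 W.
Hypothesis Wa : peval 0 W a = lv.

Let theta := mapped_node_poly that a b.

Definition top_coef (j : 'I_d) : R := (W j 0)`_r.+1 / lead_coef theta.

(** The multiple of the node polynomial is chosen to cancel the leading
coefficient.  The result has degree at most [r] and the same Hermite data as [W]: it
is the Hermite interpolant of [W]. *)
Definition reduced : 'cV[{poly R}]_d :=
  \col_j (W j 0 - top_coef j *: theta).

Lemma lead_coef_theta_neq0 : lead_coef theta != 0.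
Proof. by rewrite lead_coef_eq0 -size_poly_eq0 size_mapped_node_poly. Qed.

Lemma deg_reduced : deg_le r reduced.
Proof.
move=> j; rewrite mxE; apply/leq_sizeP => i; rewrite leq_eqVlt coefB coefZ.
move=> /predU1P[<-|ri].
  have -> : theta`_r.+1 = lead_coef theta.
    by rewrite lead_coefE size_mapped_node_poly.
  by rewrite /top_coef divfK ?lead_coef_theta_neq0// subrr.
have /leq_sizeP-> // := degW j.
have /leq_sizeP-> // : (size theta <= r.+2)%N by rewrite size_mapped_node_poly.
by rewrite mulr0 subrr.
Qed.

Lemma peval_reduced i t :
  peval i reduced t = peval i W t - theta^`(i).[t] *: \col_j top_coef j.
Proof.
apply/colP => j; rewrite !mxE linearB linearZ /= hornerD hornerN hornerZ.
by rewrite mulrC.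
Qed.

Let zl i : (i < nleft k)%N -> theta^`(i).[a] = 0.
Proof. by move: i; have [] := mapped_node_poly_zeros that ab. Qed.
Let zr i : (i <= k./2)%N -> theta^`(i).[b] = 0.
Proof. by move: i; have [] := mapped_node_poly_zeros that ab. Qed.
Let zm j : theta.[from_ref a b (that j)] = 0.
Proof. by move: j; have [] := mapped_node_poly_zeros that ab. Qed.

Lemma peval_reduced_a i : (i < nleft k)%N -> peval i reduced a = peval i W a.
Proof. by move=> /zl zi; rewrite peval_reduced zi scale0r subr0. Qed.

Lemma peval_reduced_b i : (i <= k./2)%N -> peval i reduced b = peval i W b.
Proof. by move=> /zr zi; rewrite peval_reduced zi scale0r subr0. Qed.

Lemma peval_reduced_m j :
  peval 0 reduced (from_ref a b (that j)) = peval 0 W (from_ref a b (that j)).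
Proof. by rewrite peval_reduced zm scale0r subr0. Qed.

(** The integrands for [reduced] and for [W] differ by [theta' * S] with
[S = (M c, phi)], where [c] holds the coefficients [top_coef].  Integration by
parts and orthogonality of [theta] to [S'] leave the boundary term
[- theta(a) S(a)].  It vanishes for [k > 0] because then [theta(a) = 0], and
for [k = 0] it is compensated by the jump term, as the jump of [reduced] at
[a] is [- theta(a) c]. *)
Lemma quad_reduced_deriv (phi : 'cV[{poly R}]_d) : deg_le (r - k) phi ->
  quad that a b (fun t => inner (M *m peval 1 reduced t) (peval 0 phi t))
  + (k == 0%N)%:R * inner (M *m (peval 0 reduced a - lv)) (peval 0 phi a)
  = quad that a b (horner (inner_poly M W phi)).
Proof.
move=> sphi; pose c := \col_j top_coef j.
pose S : {poly R} := \sum_(j < d) (M *m c) j 0 *: phi j 0.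
have sS : (size S <= (r - k).+1)%N.
  apply: (leq_trans (size_sum _ _ _)); apply/bigmax_leqP => j _.
  exact: leq_trans (size_scale_leq _ _) (sphi j).
have innerS t y : inner (M *m (y *: c)) (peval 0 phi t) = y * S.[t].
  rewrite -scalemxAr /inner horner_sum mulr_sumr; apply: eq_bigr => j _.
  by rewrite mxE [peval 0 phi t j 0]mxE hornerZ mulrA.
have redE : inner_poly M reduced phi = inner_poly M W phi - theta^`() * S.
  rewrite /inner_poly /S mulr_sumr -sumrB; apply: eq_bigr => j _.
  rewrite -scalerAr scalerAl -mulrBl; congr (_ * _).
  rewrite /mulM_deriv mxE scaler_suml -sumrB; apply: eq_bigr => l _.
  by rewrite !mxE derivB derivZ scalerBr scalerA.
have [I0 dI0] := ex_antideriv (inner_poly M W phi).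
have sS' : (size S^`() <= r - k)%N.
  have [->|S0] := eqVneq S 0; first by rewrite deriv0 size_poly0.
  by rewrite -ltnS; apply: leq_trans (lt_size_deriv S0) sS.
have [Z dZ Zab] := mapped_node_poly_orth zeros ab sS'.
have sI : (size (inner_poly M W phi) <= (2 * r - k).+1)%N.
  by have := size_inner_poly M degW sphi; move: (size _) => n; lia.
rewrite (quad_poly kr zeros ab (fun=> erefl) sI dI0).
rewrite (quad_poly (p := inner_poly M reduced phi) (P := I0 - theta * S + Z) kr zeros ab).
- have tb : theta.[b] = 0 by exact: (@zr 0%N).
  rewrite !hornerE Zab tb mul0r.
  have -> : peval 0 reduced a - lv = - theta.[a] *: c.
    by rewrite peval_reduced derivn0 Wa addrAC subrr add0r scaleNr.
  rewrite innerS.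
  have [k0|k0] := eqVneq k 0%N; first by rewrite /=; ring.
  have -> : theta.[a] = 0 by apply: (@zl 0%N); rewrite /nleft uphalf_gt0 lt0n.
  by rewrite /=; ring.
- by move=> t; rewrite horner_inner_poly.
- rewrite redE (leq_trans (size_polyD _ _))// geq_max sI size_polyN.
  apply: (leq_trans (size_polyMleq _ _)).
  have : (size theta^`() <= r.+1)%N.
    have st : size theta = r.+2 by rewrite size_mapped_node_poly.
    have t0' : theta != 0 by rewrite -size_poly_eq0 st.
    by rewrite -ltnS -st lt_size_deriv.
  by move: (size theta^`()) (size S) sS => x y; lia.
- by rewrite redE derivD derivB dI0 derivM dZ opprD addrA subrK.
Qed.

Section Collocation.
Variables (t0 t1 : R) (F : R -> 'cV[R]_d -> 'cV[R]_d).
Hypotheses (t0a : t0 <= a) (bt1 : b <= t1).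
Hypothesis Fsm : Cn_slab t0 t1 k./2 (fun x => F x.1 x.2).
Let FW t := F t (peval 0 W t).
Hypothesis collb : forall i, (i <= k./2)%N -> M *m peval i.+1 W b = dminus i FW b.
Hypothesis colla : forall i, (i < nleft k)%N -> M *m peval i.+1 W a = dplus i FW a.
Hypothesis collm : forall j, let t := from_ref a b (that j) in
  M *m peval 1 W t = FW t.

Let FV t := F t (peval 0 reduced t).

Let ha : a <= a <= b. Proof. by rewrite lexx ltW. Qed.
Let hb : a <= b <= b. Proof. by rewrite lexx ltW. Qed.
Let cl : id @ b^'- --> b. Proof. exact: cvg_at_left_filter. Qed.
Let cr : id @ a^'+ --> a. Proof. exact: cvg_at_right_filter. Qed.

Lemma dminus_reduced i : (i <= k./2)%N -> dminus i FV b = dminus i FW b.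
Proof.
exact: (lim_FV t0a bt1 hb (near_left_itv ab) cl (leqnn _) Fsm peval_reduced_b).
Qed.

Lemma dplus_reduced i : (i < nleft k)%N -> dplus i FV a = dplus i FW a.
Proof.
move=> ik.
have WV l : (l <= i)%N -> peval l reduced a = peval l W a.
  by move=> li; apply: peval_reduced_a; exact: leq_ltn_trans ik.
exact: (lim_FV t0a bt1 ha (near_right_itv ab) cr (ltn_nleft_half ik) Fsm WV (leqnn _)).
Qed.

(** The Hermite data of [F(t, reduced)] tested with [phi] are those of [M W'],
by the collocation conditions for [W] at each node. *)
Lemma quad_reduced (phi : 'cV[{poly R}]_d) :
  quad that a b (fun t => inner (FV t) (peval 0 phi t))
  = quad that a b (horner (inner_poly M W phi)).
Proof.
apply: quad_eq => [i ik|i ik|j].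
- have WV l : (l <= i)%N -> peval l reduced a = peval l W a.
    by move=> li; apply: peval_reduced_a; exact: leq_ltn_trans ik.
  have cW l : (l <= i)%N -> M *m peval l.+1 W a = lim (derive1n l FW s @[s --> a^'+]).
    by move=> li; apply: colla; exact: leq_ltn_trans ik.
  apply: dplus_from_ref => //.
  exact: (eqjet_coll t0a bt1 ha (near_right_itv ab) cr (ltn_nleft_half ik) Fsm WV cW phi).
- have WV l : (l <= i)%N -> peval l reduced b = peval l W b.
    by move=> li; apply: peval_reduced_b; exact: leq_trans ik.
  have cW l : (l <= i)%N -> M *m peval l.+1 W b = lim (derive1n l FW s @[s --> b^'-]).
    by move=> li; apply: collb; exact: leq_trans ik.
  apply: dminus_from_ref => //.
  exact: (eqjet_coll t0a bt1 hb (near_left_itv ab) cl ik Fsm WV cW phi).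
- by rewrite horner_inner_poly collm /FV peval_reduced_m.
Qed.

End Collocation.
End OneInterval.

(** * Norm and derivative bounds *)

Section Norms.
Context {R : realType} {d : nat}.
Implicit Types x y : 'cV[R]_d.

Lemma coord_le_enorm x j : `|x j 0| <= enorm x.
Proof.
rewrite /enorm -sqrtr_sqr ler_wsqrtr// /inner (bigD1 j)//= expr2 lerDl.
by apply: sumr_ge0 => i _; rewrite -expr2 sqr_ge0.
Qed.

Lemma enorm_le_sum x : enorm x <= \sum_j `|x j 0|.
Proof.
have S0 : 0 <= \sum_j `|x j 0| by apply: sumr_ge0.
rewrite -(ger0_norm S0) -sqrtr_sqr /enorm ler_wsqrtr// expr2 mulr_suml.
apply: ler_sum => j _; rewrite -expr2 -real_normK ?num_real// expr2.
by rewrite ler_wpM2l// (bigD1 j)//= lerDl sumr_ge0.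
Qed.

End Norms.

Lemma bounded_derivn (R : realType) (p : {poly R}) l :
  exists2 B, 0 <= B & forall s, -1 <= s <= 1 -> `|p^`(l).[s]| <= B.
Proof.
exists (\sum_(i < size p^`(l)) `|p^`(l)`_i|); first exact: sumr_ge0.
move=> s s1; rewrite horner_coef; apply: (le_trans (ler_norm_sum _ _ _)).
apply: ler_sum => i _; rewrite normrM normrX ler_piMr// exprn_ile1//.
by rewrite ler_norml.
Qed.

Lemma derivn_top (R : nzRingType) (p : {poly R}) n : (size p <= n.+1)%N ->
  p^`(n) = (p`_n *+ n`!)%:P.
Proof.
move=> sp; apply/polyP => i; rewrite coef_derivn coefC.
case: i => [|i]; first by rewrite addn0 ffactnn.
by have /leq_sizeP -> := sp; rewrite ?mul0rn// addnS ltnS leq_addr.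
Qed.

Lemma Cn_interval_derive1n (R : realType) (V : normedModType R) (a b : R) m (f : R -> V) :
  Cn_interval a b m f ->
  exists2 g : R -> V, {within `[a, b], continuous g} &
    forall t, a < t < b -> derive1n m f t = g t.
Proof.
elim: m f => [|m IH] f [cf]; first by move=> _; exists f.
move=> [f' [df /IH[g cg f'g]]]; exists g => // t tab.
rewrite derive1Sn -f'g//; apply: (eq_derive1n (a := a) (b := b)) => // s sab.
by rewrite derive1E; have := df s sab => ?; rewrite derive_val.
Qed.

(** The derivative of order [m] on the open interval extends continuously to
the compact one, where it is bounded. *)
Lemma bounded_dminus (R : realType) (d : nat) (a b : R) m (f : R -> 'cV[R]_d) :
  a < b -> Cn_interval a b m f ->
  exists2 B, 0 <= B & forall t j, a < t <= b -> `|dminus m f t j 0| <= B.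
Proof.
move=> ab /Cn_interval_derive1n[g cg fg].
have dE t : a < t <= b -> dminus m f t = g t.
  move=> /andP[ta tb]; apply: cvg_lim => //.
  have gt : g @ t^'- --> g t.
    have /subspace_continuousP/(_ t) := cg.
    rewrite /= in_itv/= tb (ltW ta) => /(_ isT); apply: cvg_trans.
    apply: cvg_app => A wA.
    have h : \forall s \near t^'-, s \in `[a, b] -> A s .
      have wA2 : \forall s \near t, s \in `[a, b] -> A s by exact: wA.
      exact: (cvg_within _ wA2).
    suff : \forall s \near t^'-, A s by [].
    apply: filterS2 h (near_left_itv ta) => s + /andP[sa st]; apply.
    by rewrite in_itv/= ltW//= ltW// (lt_le_trans st).
  apply: cvg_trans gt; apply: near_eq_cvg; near=> s.
  rewrite fg//; apply/andP; split; first by near: s; exact: nbhs_left_gt.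
  by apply: lt_le_trans tb; near: s; exact: nbhs_left_lt.
have cn : {within `[a, b], continuous (fun t => `|g t|)}.
  by move=> x; apply: continuous_comp; [exact: cg|exact: norm_continuous].
have [c _ gc] := EVT_max (ltW ab) cn.
exists `|g c| => // t j tab; rewrite dE//.
apply: le_trans (gc t _); last by rewrite in_itv/= (andP tab).2 ltW ?(andP tab).1.
rewrite /Num.Def.normr/= mx_normrE.
by apply: le_trans (le_bigmax _ _ (j, 0)).
Unshelve. all: by end_near. Qed.

(** * Meshes *)

Section Meshes.
Context {R : realType}.
Variables (t0 T : R) (m : mesh R).
Hypothesis mT : mesh_of t0 T m.

Lemma node_le i j : (i <= j)%N -> (j <= steps m)%N -> node m i <= node m j.
Proof.
case: mT => _ _ lt; elim: j => [|j IH]; first by rewrite leqn0 => /eqP ->.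
rewrite leq_eqVlt => /predU1P[-> //|ij] js.
by apply: le_trans (IH ij (ltnW js)) (ltW (lt _ js)).
Qed.

Lemma step_lt n : (n < steps m)%N -> node m n < node m n.+1.
Proof. by case: mT => _ _; apply. Qed.

Lemma node_ge n : (n <= steps m)%N -> t0 <= node m n.
Proof. by move=> ns; have := node_le (leq0n n) ns; case: mT => ->. Qed.

Lemma node_le_end n : (n <= steps m)%N -> node m n <= t0 + T.
Proof. by move=> ns; have := node_le ns (leqnn _); case: mT => _ ->. Qed.

Lemma step_le_mesh_size n : (n < steps m)%N ->
  node m n.+1 - node m n <= mesh_size m.
Proof.
move=> ns; exact: (le_bigmax _ (fun n : 'I_(steps m) => node m n.+1 - node m n) (Ordinal ns)).
Qed.

Lemma mesh_size_ge0 : 0 <= mesh_size m.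
Proof. exact: bigmax_ge_id. Qed.

Lemma mesh_size_le : 0 <= T -> mesh_size m <= T.
Proof.
move=> T0; apply: bigmax_le => // i _.
by have := node_ge (ltnW (ltn_ord i)); have := node_le_end (ltn_ord i); lra.
Qed.

End Meshes.

(** * The reduced collocation solution and its error *)

Definition reduced_pieces (R : realType) (d r k : nat) (that : 'I_(r - k) -> R)
    (m : mesh R) (W : pieces R d) : pieces R d :=
  fun n => reduced that (node m n) (node m n.+1) (W n).

(** The Hermite data of order zero at the right end points are kept, so the pieces
of the reduced solution receive the same incoming values as those of [W]. *)
Lemma vtd_reduced_pieces (R : realType) (d r k : nat) (t0 T : R)
  (M : 'M[R]_d) (F : R -> 'cV[R]_d -> 'cV[R]_d) (u0 : 'cV[R]_d)
  (that : 'I_(r - k) -> R) (m : mesh R) (W : pieces R d) :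
  (k <= r)%N -> jacobi_zeros that -> mesh_of t0 T m ->
  Cn_slab t0 (t0 + T) k./2 (fun x => F x.1 x.2) ->
  collocation that M F u0 m W ->
  vtd that M F u0 m (reduced_pieces that m W).
Proof.
move=> kr zeros mT Fsm [degW collW].
have nlt n (ns : (n < steps m)%N) := step_lt mT ns.
have nge n (ns : (n < steps m)%N) := node_ge mT (ltnW ns).
have nle n (ns : (n < steps m)%N) := node_le_end mT ns.
split=> n ns.
  by apply: deg_reduced => //; [exact: nlt|exact: degW].
have lvE : left_value m u0 (reduced_pieces that m W) n = left_value m u0 W n.
  case: n ns => [//|n] ns /=.
  by apply: peval_reduced_b => //; apply: nlt; exact: ltnW.
rewrite lvE => a b FV; have [Wa collb colla collm] := collW n ns.
have ab : a < b by exact: nlt.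
have t0a : t0 <= a by exact: nge.
have bt1 : b <= t0 + T by exact: nle.
split=> [k1|i ik|i ik|phi sphi].
- by rewrite -Wa; apply: (peval_reduced_a that _ ab); rewrite /nleft uphalf_gt0.
- rewrite (dminus_reduced that _ ab t0a bt1 Fsm (ltnW ik)) -collb ?(ltnW ik)//.
  by congr (M *m _); apply: peval_reduced_b.
- have ik' : (i.+1 < nleft k)%N by move: ik; case: (k).
  rewrite (dplus_reduced that _ ab t0a bt1 Fsm (ltnW ik')) -colla ?(ltnW ik')//.
  by congr (M *m _); apply: peval_reduced_a.
- rewrite (quad_reduced_deriv M kr zeros ab (degW n ns) Wa sphi).
  by rewrite (quad_reduced ab t0a bt1 Fsm collb colla collm).
Qed.

(** The coefficient [top_coef] is of order [(b - a)^(r+1)], because it divides the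
bounded leading coefficient of [W] by the leading coefficient
[(2 / (b - a))^(r+1)] of [theta], while the [l]-th derivative of [theta] is of
order [(b - a)^(-l)]. *)
Lemma reduced_error (R : realType) (d r k l : nat) (that : 'I_(r - k) -> R) :
  (k <= r)%N -> (l <= r)%N ->
  exists2 K, 0 <= K & forall (a b D t : R) (W : 'cV[{poly R}]_d) (v : 'cV[R]_d),
    a < b -> a < t <= b -> deg_le r.+1 W ->
    (forall j, `|peval r.+1 W b j 0| <= D) ->
    enorm (v - peval l (reduced that a b W) t)
      <= d%:R * enorm (v - peval l W t) + K * D * (b - a) ^+ (r.+1 - l).
Proof.
move=> kr lr; have [B B0 hB] := bounded_derivn (node_poly that) l.
(* the sum over the [d] components gives the factor [d], the rest bounds
   (2 / (b - a))^l * B / (2 / (b - a))^(r+1) *)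
exists (d%:R * B * (2 ^- r.+1 * 2 ^+ l)).
  by rewrite !mulr_ge0// ?invr_ge0 exprn_ge0.
move=> a b D t W v ab /andP[ta tb] degW hD.
have h0 : 0 < b - a by rewrite subr_gt0.
apply: (le_trans (enorm_le_sum _)).
have -> : d%:R * enorm (v - peval l W t)
     + d%:R * B * (2 ^- r.+1 * 2 ^+ l) * D * (b - a) ^+ (r.+1 - l)
   = \sum_(j < d) (enorm (v - peval l W t)
       + B * (2 ^- r.+1 * 2 ^+ l) * D * (b - a) ^+ (r.+1 - l)).
  rewrite sumr_const card_ord -[RHS]mulr_natl; ring.
apply: ler_sum => j _; rewrite peval_reduced opprB addrCA addrC.
rewrite mxE; apply: (le_trans (ler_normD _ _)); apply: lerD.
  exact: coord_le_enorm.
rewrite !mxE horner_derivn_mapped// /top_coef lead_coef_mapped_node_poly//.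
have wD : `|(W j 0)`_r.+1| <= D.
  apply: le_trans (hD j); rewrite mxE derivn_top// hornerC normrMn.
  by rewrite -[leRHS]mulr_natr ler_peMr// ler1n fact_gt0.
have sB : `|(node_poly that)^`(l).[to_ref a b t]| <= B.
  apply: hB; rewrite /to_ref ler_pdivlMr// ler_pdivrMr//.
  by apply/andP; split; lra.
set w := _`_r.+1 in wD *; set N := _.[_] in sB *.
have -> : (2 / (b - a)) ^+ l * N * (w / (2 / (b - a)) ^+ r.+1)
   = (2 ^- r.+1 * 2 ^+ l * (b - a) ^+ (r.+1 - l)) * (N * w).
  have -> : (b - a) ^+ (r.+1 - l) = (b - a) ^+ r.+1 * (b - a) ^- l.
    by rewrite expfB_cond// gt_eqF// add0n leqW.
  rewrite !exprMn !exprVn; field.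
  by rewrite !expf_neq0 ?pnatr_eq0// gt_eqF.
have c0 : 0 <= 2 ^- r.+1 * 2 ^+ l * (b - a) ^+ (r.+1 - l).
  by rewrite !mulr_ge0 ?invr_ge0 ?exprn_ge0// ltW.
rewrite normrM (ger0_norm c0) normrM.
have -> : B * (2 ^- r.+1 * 2 ^+ l) * D * (b - a) ^+ (r.+1 - l) =
   (2 ^- r.+1 * 2 ^+ l * (b - a) ^+ (r.+1 - l)) * (B * D) by ring.
by rewrite ler_wpM2l// ler_pM.
Qed.

Lemma sup_error_leP (R : realType) (d : nat) (m : mesh R) (u : R -> 'cV[R]_d)
    (V : pieces R d) l (X : R) :
  (sup_error m u V l <= X%:E)%E <->
  forall n t, (n < steps m)%N -> node m n < t <= node m n.+1 ->
    enorm (dminus l u t - peval l (V n) t) <= X.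
Proof.
split=> [h n t ns tn|h].
  rewrite -lee_fin; apply: le_trans h; apply: ereal_sup_ubound.
  by exists n, t.
by apply: ge_ereal_sup => _ [n [t [ns tn ->]]]; rewrite lee_fin h.
Qed.

(** The exponent [e] only has to reach the order [r + 1 - l] of the correction:
both min(2r - k + 1, r + 2) for [l = 0] and [r + 2 - l] for [l > 0] do.
The estimate of order [r + 1] for the collocation solution bounds its leading
coefficient uniformly over the meshes. *)
Lemma vtd_error (R : realType) (d r k l e : nat) (t0 T : R)
  (M : 'M[R]_d) (F : R -> 'cV[R]_d -> 'cV[R]_d) (u0 : 'cV[R]_d)
  (u : R -> 'cV[R]_d) (that : 'I_(r - k) -> R)
  (meshes : set (mesh R)) (Ut U : mesh R -> pieces R d) :
  (k <= r)%N -> (l <= r)%N -> (r.+1 - l <= e)%N -> 0 < T ->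
  Cn_slab t0 (t0 + T) k./2 (fun x => F x.1 x.2) ->
  Cn_interval t0 (t0 + T) r.+1 u ->
  jacobi_zeros that ->
  (forall m, meshes m -> mesh_of t0 T m) ->
  (forall m, meshes m -> collocation that M F u0 m (Ut m)) ->
  (forall m, meshes m -> unique_solution m (vtd that M F u0 m) (U m)) ->
  (exists C : R, forall m, meshes m ->
     (sup_error m u (Ut m) l <= (C * mesh_size m ^+ e)%:E)%E) ->
  (exists C : R, forall m, meshes m ->
     (sup_error m u (Ut m) r.+1 <= (C * mesh_size m)%:E)%E) ->
  exists C : R, forall m, meshes m ->
     (sup_error m u (U m) l <= (C * mesh_size m ^+ (r.+1 - l))%:E)%E.
Proof.
move=> kr lr le T0 Fsm usm zeros mT coll vtdU [C1 hC1] [C2 hC2].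
have [K K0 hK] := reduced_error d that kr lr.
have [|B B0 hB] := bounded_dminus _ usm; first by lra.
(* bound for the top derivative of the collocation solution, using tau <= T *)
pose D := B + `|C2| * T.
exists (d%:R * (`|C1| * T ^+ (e - (r.+1 - l))) + K * D) => m mm.
have mTm := mT m mm; have tau0 := mesh_size_ge0 m.
have tauT := mesh_size_le mTm (ltW T0).
apply/sup_error_leP => n t ns tn.
have [_ uniqU] := vtdU m mm.
rewrite -(uniqU _ (vtd_reduced_pieces kr zeros mTm Fsm (coll m mm)) n ns).
have ab := step_lt mTm ns.
have degW := (coll m mm).1 n ns.
have hD j : `|peval r.+1 (Ut m n) (node m n.+1) j 0| <= D.
  have bn : node m n < node m n.+1 <= node m n.+1 by rewrite ab lexx.
  have ub : t0 < node m n.+1 <= t0 + T.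
    by rewrite (node_le_end mTm ns) andbT (le_lt_trans (node_ge mTm (ltnW ns))).
  have := (sup_error_leP _ _ _ _ _).1 (hC2 m mm) n _ ns bn.
  move=> /(le_trans (coord_le_enorm _ j)); rewrite !mxE => e2.
  have C2T : C2 * mesh_size m <= `|C2| * T.
    by apply: le_trans (ler_norm _) _; rewrite normrM (ger0_norm tau0) ler_wpM2l.
  rewrite /D; move: (hB _ j ub) e2; set y := _.[_].
  move: (fun_of_matrix (dminus r.+1 u (node m n.+1)) j 0) => x e1 e2.
  by have := ler_normB x (x - y); rewrite subKr; lra.
apply: le_trans (hK _ _ D t _ _ ab tn degW hD) _.
rewrite mulrDl; apply: lerD; last first.
  rewrite ler_wpM2l ?mulr_ge0 ?addr_ge0 ?mulr_ge0 ?(ltW T0)//.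
  apply: lerXn2r; rewrite ?nnegrE ?subr_ge0 ?(ltW ab)//.
  exact: step_le_mesh_size.
rewrite -!mulrA ler_wpM2l//.
apply: le_trans ((sup_error_leP _ _ _ _ _).1 (hC1 m mm) n t ns tn) _.
apply: le_trans (ler_norm _) _; rewrite normrM ler_wpM2l// ger0_norm ?exprn_ge0//.
rewrite -{1}(subnK le) exprD ler_wpM2r ?exprn_ge0//.
by apply: lerXn2r; rewrite ?nnegrE// ltW.
Qed.

Theorem corollary4p7 (R : realType) (d r k : nat) (t0 T : R)
  (M : 'M[R]_d) (F : R -> 'cV[R]_d -> 'cV[R]_d) (u0 : 'cV[R]_d)
  (u : R -> 'cV[R]_d) (that : 'I_(r - k) -> R)
  (meshes : set (mesh R)) (Ut U : mesh R -> pieces R d) :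
  (k <= r)%N ->
  0 < T ->
  M \in unitmx ->
  Cn_slab t0 (t0 + T) k./2 (fun x => F x.1 x.2) ->
  lipschitz_snd t0 (t0 + T) F ->
  exact_solution t0 T M F u0 u ->
  Cn_interval t0 (t0 + T) r.+1 u ->
  jacobi_zeros that ->
  (forall m, meshes m -> mesh_of t0 T m) ->
  (forall m, meshes m ->
     unique_solution m (collocation that M F u0 m) (Ut m)) ->
  (forall m, meshes m ->
     unique_solution m (vtd that M F u0 m) (U m)) ->
  (exists C : R, forall m, meshes m ->
     (sup_error m u (Ut m) 0 <=
        (C * mesh_size m ^+ minn (2 * r - k + 1) (r.+1 + 1))%:E)%E) ->
  (forall l, (1 <= l <= r.+1)%N -> exists C : R, forall m, meshes m ->
     (sup_error m u (Ut m) l <= (C * mesh_size m ^+ (r.+1 + 1 - l))%:E)%E) ->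
  (exists C : R, forall m, meshes m ->
     (sup_error m u (U m) 0 <= (C * mesh_size m ^+ r.+1)%:E)%E) /\
  (forall l, (1 <= l <= r)%N -> exists C : R, forall m, meshes m ->
     (sup_error m u (U m) l <= (C * mesh_size m ^+ (r.+1 - l))%:E)%E).
Proof.
move=> kr T0 _ Fsm _ _ usm zeros mT collU vtdU h0 hl.
have coll m : meshes m -> collocation that M F u0 m (Ut m).
  by move=> mm; case: (collU m mm).
have htop : exists C : R, forall m, meshes m ->
    (sup_error m u (Ut m) r.+1 <= (C * mesh_size m)%:E)%E.
  have [|C hC] := hl r.+1; first by rewrite leqnn.
  by exists C => m /hC; rewrite addn1 subSn// subnn expr1.
split=> [|l /andP[l1 lr]].
  have := vtd_error kr (leq0n r) _ T0 Fsm usm zeros mT coll vtdU h0 htop.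
  by rewrite subn0; apply; rewrite leq_min; lia.
apply: (vtd_error kr lr _ T0 Fsm usm zeros mT coll vtdU (hl l _) htop).
  by rewrite addn1 leq_sub2r.
by rewrite l1 ltnW.
Qed.
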